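(* Let $P$ be an $L$-Fourier multiplier with symbol $\sigma_P:\mathcal I\to\mathbb C$. Then $P$ is globally $L$-solvable if and only if there exists $M>0$ such that $$|\sigma_P(\xi)|>\langle\xi\rangle^{-M}$$ whenever $\sigma_P(\xi)\neq0$ (that is, for every $\xi\in\mathcal I$ with $\sigma_P(\xi)\ne 0$).
   Context: Setting. $\Omega\subset\mathbb R^n$ is a bounded open set and $L$ is a differential operator of order $m$ with smooth coefficients in $\Omega$, equipped with linear boundary conditions (BC), meaning that the space of functions satisfying them is linear. $L$ is assumed to have a discrete spectrum $\{\lambda_\xi\in\mathbb C:\xi\in\mathcal I\}$, where $\mathcal I$ is a countable set (without loss of generality $\mathcal I\subset\mathbb Z^K$ for some $K\ge1$), with $|\lambda_\xi|\to\infty$ as $|\xi|\to\infty$, ordered so that $|j|\le|k|\Rightarrow|\lambda_j|\le|\lambda_k|$. $L$ need not be self-adjoint or elliptic. $L^*$ is the adjoint, with conjugate boundary conditions (BC)*. The eigenfunctions satisfy $Lu_\xi=\lambda_\xi u_\xi$ (with (BC)) and $L^*v_\xi=\overline{\lambda_\xi}v_\xi$ (with (BC)* ). The systems $\{u_\xi\}_{\xi\in\mathcal I}$ and $\{v_\xi\}_{\xi\in\mathcal I}$ are taken biorthogonal, $(u_\xi,v_\eta)_{L^2(\Omega)}=\int_\Omega u_\xi\overline{v_\eta}\,dx=1$ if $\xi=\eta$ and $0$ if $\xi\ne\eta$, with $\|u_\xi\|_{L^2(\Omega)}=\|v_\xi\|_{L^2(\Omega)}=1$ for all $\xi\in\mathcal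 I$. It is assumed that $\{u_\xi\}$ is a basis of $L^2(\Omega)$, which implies that $\{v_\xi\}$ is also a basis of $L^2(\Omega)$. Weight: $\langle\xi\rangle:=(1+|\lambda_\xi|^2)^{1/(2m)}$. Test functions: $H^\infty_L(\overline\Omega):=\bigcap_{k\ge1}\mathrm{Dom}(L^k)$, where $\mathrm{Dom}(L^k)=\{f\in L^2(\Omega):L^jf\in\mathrm{Dom}(L),\ j=0,1,\dots,k-1\}$ and $L^k$ is equipped with the same boundary conditions (BC); the Fréchet topology is given by the seminorms $\|\varphi\|_{H^k_L}=\max_{j\le k}\|L^j\varphi\|_{L^2(\Omega)}$, $k=0,1,2,\dots$. The space $H^\infty_{L^*}(\overline\Omega)$ is defined likewise from $L^*$. It is assumed that, for $L_0$ denoting $L$ or $L^*$, if $f_j\in H^\infty_{L_0}(\overline\Omega)$ and $f_j\to f$ in $H^\infty_{L_0}(\overline\Omega)$, then $f\in H^\infty_{L_0}(\overline\Omega)$. The space of $L$-distributions $H^{-\infty}_L(\Omega)$ is the space of continuous linear functionals on $H^\infty_{L^*}(\overline\Omega)$, with pairing written $\langle w,\varphi\rangle$; $H^\infty_L(\overline\Omega)$ embeds in it via $\langle\psi,\varphi\rangle=\int_\Omega\psi\varphi\,dx$. $\mathcal S(\mathcal I)$ is the space of functions $\varphi:\mathcal I\to\mathbb C$ such that for every $M>0$ there is $C_M>0$ with $|\varphi(\xi)|\le C_M\langle\xi\rangle^{-M}$. $\mathcal S'(\mathcal I)$ is the space of functions with $|\varphi(\xi)|\le C\langle\xi\rangle^M$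 for some $C,M>0$. The $L$-Fourier transform is $\widehat f(\xi)=(f,v_\xi)_{L^2(\Omega)}$ for test functions and $\widehat w(\xi)=\langle w,\overline{v_\xi}\rangle$ for $L$-distributions; it is a bijective homeomorphism from $H^\infty_L(\overline\Omega)$ to $\mathcal S(\mathcal I)$ and from $H^{-\infty}_L(\Omega)$ to $\mathcal S'(\mathcal I)$. An $L$-Fourier multiplier with symbol $\sigma_A:\mathcal I\to\mathbb C$ is a continuous linear operator $A:H^\infty_L(\overline\Omega)\to H^\infty_L(\overline\Omega)$ with $\widehat{Af}(\xi)=\sigma_A(\xi)\widehat f(\xi)$ for all $f\in H^\infty_L(\overline\Omega)$. It extends to $H^{-\infty}_L(\Omega)$ by $\langle Aw,\varphi\rangle:=\langle w,\overline{A^*\overline\varphi}\rangle$ for $\varphi\in H^\infty_{L^*}(\overline\Omega)$, where $A^*:H^\infty_{L^*}(\overline\Omega)\to H^\infty_{L^*}(\overline\Omega)$ is the adjoint of $A$; then $\widehat{Aw}(\xi)=\sigma_A(\xi)\widehat w(\xi)$ also for $w\in H^{-\infty}_L(\Omega)$. The space of $P$-admissible $L$-distributions is $\mathbb E:=\{f\in H^{-\infty}_L(\Omega):\ \sigma_P(\xi)=0\Rightarrow\widehat f(\xi)=0\}$. $P$ is globally $L$-solvable if $PH^{-\infty}_L(\Omega)=\mathbb E$, that is, if for every $f\in\mathbb E$ there exists $w\in H^{-\infty}_L(\Omega)$ with $Pw=f$.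
   Formalization: The inequality is required only for ξ with σ_P(ξ)≠0 and λ_ξ≠0: if λ_ξ=0 then ⟨ξ⟩=1 and the printed bound would demand |σ_P(ξ)|>1, which fails for the solvable identity; test functions for L-distributions are the φ with conjugate in H^∞_{L*}. *)

(* Defs.v *)
Set Warnings "-all".
From HB Require Import structures.
From mathcomp Require Import all_boot all_order all_algebra complex ring_quotient.
From mathcomp Require Import all_classical all_reals all_analysis.
Set Implicit Arguments. Unset Strict Implicit. Unset Printing Implicit Defensive.
Import Order.TTheory GRing.Theory Num.Theory.
Import numFieldNormedType.Exports.
Local Open Scope classical_set_scope.
Local Open Scope ring_scope.

(** Lebesgue measure on [n.-tuple R], by recursion on [n] as the image of the
    product measure under [(x, t) |-> x :: t]; it is then transported to
    ['rV[R]_n], which is given the product (= Borel) sigma-algebra. *)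


Section tuple_lebesgue.
Context (R : realType).
Local Notation mR := (measurableTypeR R).

Definition tcons n (x : mR * n.-tuple mR) : n.+1.-tuple mR :=
  [the n.+1.-tuple mR of x.1 :: x.2].
Definition tuncons n (t : n.+1.-tuple mR) : mR * n.-tuple mR :=
  (thead t, [tuple of behead t]).

Lemma tconsK n : cancel (@tcons n) (@tuncons n).
Proof. by case=> x t; rewrite /tuncons/tcons/=; congr pair; apply/val_inj. Qed.

Lemma measurable_tcons n : measurable_fun [set: mR * n.-tuple mR] (@tcons n).
Proof. exact: measurable_cons. Qed.

Lemma measurable_tuncons n :
  measurable_fun [set: n.+1.-tuple mR] (@tuncons n).
Proof.
by apply/measurable_fun_pair; [exact: measurable_tnth|exact: measurable_behead].
Qed.

Section step.
Context n (m : {sigma_finite_measure set (n.-tuple mR) -> \bar R}).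

Definition lebesgue_cons : set (n.+1.-tuple mR) -> \bar R :=
  pushforward (lebesgue_measure \x m)%E (@tcons n).

HB.instance Definition _ := Measure.copy lebesgue_cons
  (measure_function_pushforward__canonical__measure_function_Measure
     (lebesgue_measure \x m)%E (@measurable_tcons n)).

Lemma lebesgue_cons_sigma_finite : sigma_finite setT lebesgue_cons.
Proof.
have /sigma_finiteP[F [TF ndF Foo]] := sigma_finiteT (@lebesgue_measure R).
have /sigma_finiteP[G [TG ndG Goo]] := sigma_finiteT m.
pose FG k := F k `*` G k.
have TFG : [set: mR * n.-tuple mR] = \bigcup_k FG k.
  rewrite -setXTT TF TG predeqE => -[x y]; split.
    move=> [/= [k _ Fkx] [l _ Gly]]; exists (maxn k l) => //; split.
    - by move: x Fkx; exact/subsetPset/ndF/leq_maxl.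
    - by move: y Gly; exact/subsetPset/ndG/leq_maxr.
  by move=> [k _ []/= ? ?]; split; exists k.
exists (fun k => @tuncons n @^-1` FG k).
  by rewrite -preimage_bigcup -TFG preimage_setT.
move=> k; have [[mF oF] [mG oG]] := (Foo k, Goo k).
have mFG : measurable (FG k) by exact: measurableX.
split; first by rewrite -[X in measurable X]setTI; exact: measurable_tuncons.
rewrite /lebesgue_cons /pushforward -comp_preimage.
rewrite (_ : _ \o _ = id) ?preimage_id.
  by rewrite /FG product_measure1E// lte_mul_pinfty// ge0_fin_numE.
by apply/funext => x; exact: tconsK.
Qed.

HB.instance Definition _ :=
  Measure_isSigmaFinite.Build _ _ _ lebesgue_cons lebesgue_cons_sigma_finite.

End step.

Fixpoint lebesgue_tuple n :
    {sigma_finite_measure set (n.-tuple mR) -> \bar R} :=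
  match n return {sigma_finite_measure set (n.-tuple mR) -> \bar R} with
  | 0 => \d_ [tuple]
  | n'.+1 => lebesgue_cons (lebesgue_tuple n')
  end.

End tuple_lebesgue.

Section rV_lebesgue.
Context (R : realType) (n : nat).
Local Notation mR := (measurableTypeR R).

Let coord (i : 'I_n) (x : 'rV[R]_n) : mR := x ord0 i.

Let rV_set0 : g_sigma_preimage coord set0.
Proof. exact: sigma_algebra0. Qed.

Let rV_setC A : g_sigma_preimage coord A -> g_sigma_preimage coord (~` A).
Proof. exact: sigma_algebraC. Qed.

Let rV_bigcup (F : (set 'rV[R]_n)^nat) :
  (forall i, g_sigma_preimage coord (F i)) ->
  g_sigma_preimage coord (\bigcup_i (F i)).
Proof. exact: sigma_algebra_bigcup. Qed.

HB.instance Definition _ :=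
  @isMeasurable.Build (measure_tuple_display default_measure_display)
    'rV[R]_n (g_sigma_preimage coord) rV_set0 rV_setC rV_bigcup.

Lemma measurable_coord (i : 'I_n) :
  measurable_fun [set: 'rV[R]_n] (fun x : 'rV[R]_n => x ord0 i : mR).
Proof.
move=> _ Y mY; rewrite setTI; apply: sub_sigma_algebra => /=.
rewrite -bigcup_seq/=; exists i => /=; first by rewrite mem_index_enum.
by exists Y => //; rewrite setTI.
Qed.

Definition row_of_tuple (t : n.-tuple mR) : 'rV[R]_n := \row_i tnth t i.

Lemma measurable_row_of_tuple :
  measurable_fun [set: n.-tuple mR] row_of_tuple.
Proof.
have H : g_sigma_preimage coord `<=`
    [set A | measurable (row_of_tuple @^-1` A)].
  apply: smallest_sub.
    split => [|A /= mA|F /= mF].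
    - by rewrite /= preimage_set0.
    - by rewrite setTD preimage_setC; exact: measurableC.
    - by rewrite preimage_bigcup; exact: bigcupT_measurable.
  rewrite -bigcup_seq/= => A [i _] /= [B mB]; rewrite setTI => <-{A} /=.
  rewrite -comp_preimage.
  rewrite (_ : _ \o _ = (@tnth n mR)^~ i).
    by rewrite -[X in measurable X]setTI; exact: measurable_tnth.
  by apply/funext => t /=; rewrite /coord mxE.
by move=> _ A mA; rewrite setTI; exact: H.
Qed.

Definition lebesgue_rV : set 'rV[R]_n -> \bar R :=
  pushforward (lebesgue_tuple R n) row_of_tuple.

HB.instance Definition _ := Measure.copy lebesgue_rV
  (measure_function_pushforward__canonical__measure_function_Measure
     (lebesgue_tuple R n) measurable_row_of_tuple).

Lemma open_measurable_rV (A : set 'rV[R]_n) : open A -> measurable A.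
Proof.
move=> oA.
pose box (q : 'rV[rat]_n * rat) : set 'rV[R]_n :=
  [set x | forall i, `|x ord0 i - ratr (q.1 ord0 i)| < ratr q.2].
have mbox q : measurable (box q).
  rewrite (_ : box q = \bigcap_(i in [set: 'I_n])
     ((fun x : 'rV[R]_n => x ord0 i : mR) @^-1`
       `](ratr (q.1 ord0 i) - ratr q.2), (ratr (q.1 ord0 i) + ratr q.2)[%classic)).
    apply: fin_bigcap_measurable => // i _.
    by rewrite -[X in measurable X]setTI; apply: measurable_coord.
  apply/seteqP; split => x /= Hx i.
    by move=> _; rewrite /= in_itv/= -ltr_distlC distrC; exact: Hx.
  by have := Hx i I; rewrite /= in_itv/= -ltr_distlC distrC.
pose F (q : 'rV[rat]_n * rat) : set 'rV[R]_n :=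
  if `[< box q `<=` A >] then box q else set0.
have -> : A = \bigcup_q F q.
  apply/seteqP; split => [x Ax|x [q _]]; last first.
    by rewrite /F; case: ifPn => // /asboolP; exact.
  have : nbhs x A by exact: open_nbhs_nbhs.
  move=> /nbhs_ballP[e /= e0 xeA].
  have [r] : exists r : rat, (ratr r : R) \in `]0, (e / 2)[%R.
    by apply: rat_in_itvoo; rewrite divr_gt0.
  rewrite in_itv/= => /andP[r0 re].
  have /choice[q Hq] : forall i : 'I_n, exists q : rat,
      `|x ord0 i - ratr q| < (ratr r : R).
    move=> i; have [q] : exists q : rat,
        (ratr q : R) \in `](x ord0 i - ratr r), (x ord0 i + ratr r)[%R.
      by apply: rat_in_itvoo; rewrite ltrD2l gtrN.
    by rewrite in_itv/= => /andP[q1 q2]; exists q; rewrite ltr_distlC q1 q2.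
  exists (\row_i q i, r) => //; rewrite /F ifT; last first.
    apply/asboolP => y Hy; apply: xeA; split => // i j.
    rewrite ord1 /ball/= (splitr e).
    rewrite (le_lt_trans (ler_distD (ratr (q j)) _ _))// ltrD//.
      by rewrite (lt_trans (Hq j)).
    by rewrite distrC; have := Hy j; rewrite /= mxE => /lt_trans; exact.
  by move=> i; rewrite /= mxE.
apply: countable_bigcupT_measurable => [|q]; first exact: countableP.
by rewrite /F; case: ifPn.
Qed.

End rV_lebesgue.

Section complex_L2.
Context d (T : measurableType d) (R : realType)
  (mu : {measure set T -> \bar R}).

Definition square_integrable : {pred T -> R[i]} := [pred f |
  ((fun x => complex.Re (f x)) \in Lfun mu 2%:E) &&
  ((fun x => complex.Im (f x)) \in Lfun mu 2%:E)].

Lemma square_integrable_submod_closed : submod_closed square_integrable.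
Proof.
have p1 : (1 <= 2%:E :> \bar R)%E by rewrite lee_fin ler1n.
have LZ r (f : T -> R) : f \in Lfun mu 2%:E -> (fun x => r * f x) \in Lfun mu 2%:E.
  move=> /(@Lfun_scale _ _ _ _ _ r 2); rewrite ler1n => /(_ isT).
  by rewrite (_ : _ \o* _ = fun x => r * f x)//; apply/funext => x /=; rewrite mulrC.
pose Lsub := Lfun_submod_closed mu p1.
have LD (f g : T -> R) : f \in Lfun mu 2%:E -> g \in Lfun mu 2%:E ->
    (fun x => f x + g x) \in Lfun mu 2%:E.
  by move=> Lf Lg; have := Lsub.2 1 f g Lf Lg; rewrite scale1r.
have LN (f : T -> R) : f \in Lfun mu 2%:E -> (fun x => - f x) \in Lfun mu 2%:E.
  move=> /(LZ (-1)); rewrite (_ : (fun x => _) = fun x => - f x)//.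
  by apply/funext => x; rewrite mulN1r.
split.
  rewrite inE; apply/andP; split; exact: Lsub.1.
move=> [a b] f g; rewrite !inE => /andP[Rf If] /andP[Rg Ig].
rewrite (_ : (fun x => complex.Re _) = fun x => (a * complex.Re (f x)
    + - (b * complex.Im (f x))) + complex.Re (g x)); last first.
  apply/funext => x; rewrite -[(_ + _) x]/((a +i* b)%C * f x + g x).
  by case: (f x) (g x) => [? ?] [? ?].
rewrite (_ : (fun x => complex.Im _) = fun x => (a * complex.Im (f x)
    + b * complex.Re (f x)) + complex.Im (g x)); last first.
  apply/funext => x; rewrite -[(_ + _) x]/((a +i* b)%C * f x + g x).
  by case: (f x) (g x) => [? ?] [? ?].
apply/andP; split.
  by apply: (LD _ _) => //; apply: (LD _ _); [exact: LZ|apply: (LN _); exact: LZ].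
by apply: (LD _ _) => //; apply: (LD _ _); exact: LZ.
Qed.

HB.instance Definition _ := GRing.isSubmodClosed.Build R[i] (T -> R[i])
  square_integrable square_integrable_submod_closed.

Record L2fun := MkL2fun {
  L2fun_val :> T -> R[i];
  L2fun_valP : L2fun_val \in square_integrable }.

HB.instance Definition _ := [isSub for L2fun_val].
HB.instance Definition _ := [Choice of L2fun by <:].
HB.instance Definition _ := [SubChoice_isSubLmodule of L2fun by <:].

Definition L2null : {pred L2fun} :=
  [pred f : L2fun | `[< {ae mu, forall x, f x = 0} >]].

Lemma L2null_zmod_closed : zmod_closed L2null.
Proof.
split=> [|f g /asboolP f0 /asboolP g0].
  by apply/asboolP; apply: aeW.
apply/asboolP.
apply: filterS2 f0 g0 => x fx gx.
rewrite -[L2fun_val (f - g) x]/(f x - g x).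
by rewrite fx gx subr0.
Qed.

HB.instance Definition _ := GRing.isZmodClosed.Build L2fun L2null
  L2null_zmod_closed.

Definition L2space : Type := Quotient.quot L2null.

HB.instance Definition _ := Choice.on L2space.
HB.instance Definition _ := GRing.Zmodule.on L2space.

Definition L2class (f : L2fun) : L2space := \pi_(Quotient.quot L2null)%qT f.
Definition L2repr (f : L2space) : L2fun := repr (f : Quotient.quot L2null).

Definition L2scale (a : R[i]) (f : L2space) : L2space :=
  L2class (a *: L2repr f).

Lemma L2reprK : cancel L2repr L2class. Proof. exact: reprK. Qed.

Lemma L2class_eq (f g : L2fun) :
  L2class f = L2class g <-> {ae mu, forall x, f x = g x}.
Proof.
have E : (f - g \in L2null) = (L2class f == L2class g).
  exact: Quotient.idealrBE.
split=> [/eqP|fg].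
  rewrite -E => /asboolP; apply: filterS => x.
  by rewrite -[L2fun_val (f - g) x]/(f x - g x) => /eqP; rewrite subr_eq0 => /eqP.
apply/eqP; rewrite -E; apply/asboolP; move: fg; apply: filterS => x fg.
by rewrite -[L2fun_val (f - g) x]/(f x - g x) fg subrr.
Qed.

Lemma L2classD (f g : L2fun) : L2class (f + g) = L2class f + L2class g.
Proof. exact: Quotient.pi_add. Qed.

Lemma L2classZ a (f : L2fun) : L2class (a *: f) = L2scale a (L2class f).
Proof.
apply/L2class_eq.
have /L2class_eq := L2reprK (L2class f).
apply: filterS => x fx.
by rewrite -[L2fun_val (a *: f) x]/(a * f x) -fx.
Qed.

Lemma L2scaleA a b v : L2scale a (L2scale b v) = L2scale (a * b) v.
Proof. by rewrite -[v]L2reprK -!L2classZ scalerA. Qed.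
Lemma L2scale1 : left_id 1 L2scale.
Proof. by move=> v; rewrite -[v]L2reprK -!L2classZ scale1r. Qed.
Lemma L2scaleDr : right_distributive L2scale +%R.
Proof.
move=> a u v; rewrite -[u]L2reprK -[v]L2reprK.
by rewrite -!(L2classZ, L2classD) scalerDr.
Qed.
Lemma L2scaleDl v : {morph L2scale^~ v : a b / a + b}.
Proof.
move=> a b; rewrite -[v]L2reprK.
by rewrite -!(L2classZ, L2classD) scalerDl.
Qed.

HB.instance Definition _ := GRing.Zmodule_isLmodule.Build R[i] L2space
  L2scaleA L2scale1 L2scaleDr L2scaleDl.

End complex_L2.

Section L2_hilbert.
Context d (T : measurableType d) (R : realType)
  (mu : {measure set T -> \bar R}).
Local Notation V := (L2space mu).

Definition cintegral (f : T -> R[i]) : R[i] :=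
  Complex (\int[mu]_x complex.Re (f x)) (\int[mu]_x complex.Im (f x)).

Definition inner (f g : V) : R[i] :=
  cintegral (fun x => L2repr f x * conjc (L2repr g x)).

Definition L2norm (f : V) : R := Num.sqrt (complex.Re (inner f f)).

Lemma square_integrable_conj (f : L2fun mu) :
  (fun x => conjc (f x)) \in square_integrable mu.
Proof.
have /andP[Rf If] := L2fun_valP f.
have RE : (fun x => complex.Re (conjc (f x))) = fun x => complex.Re (f x).
  by apply/funext => x; case: (f x).
have IE : (fun x => complex.Im (conjc (f x))) =
    -1 \o* (fun x => complex.Im (f x)).
  by apply/funext => x /=; case: (f x) => ? ?; rewrite mulrN1.
by apply/andP; rewrite RE IE; split=> //; apply: Lfun_scale; rewrite ?ler1n.
Qed.

Definition L2conj (f : V) : V :=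
  L2class (MkL2fun (square_integrable_conj (L2repr f))).

(** An unbounded operator on [V]; the values of [act] outside [dom] are
    irrelevant. *)
Record operator := Operator { dom : set V; act :> V -> V }.

Definition adjoint_rel (A : operator) (g h : V) : Prop :=
  forall f, dom A f -> inner (A f) g = inner f h.

(** Hilbert space adjoint.  When [dom A] is dense there is at most one [h] such
    that [adjoint_rel A g h], so that [xget] chooses it whenever it exists. *)
Definition adjoint (A : operator) : operator :=
  Operator [set g | exists h, adjoint_rel A g h]
           (fun g => xget 0 [set h | adjoint_rel A g h]).

Definition dom_pow (A : operator) (k : nat) : set V :=
  [set f | forall j, (j < k)%N -> dom A (iter j A f)].

(** The space H^oo of the operator [A] and its defining seminorms. *)
Definition Hinf (A : operator) : set V :=
  \bigcap_(k in [set k | (1 <= k)%N]) dom_pow A k.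

Definition Hnorm (A : operator) (k : nat) (f : V) : R :=
  \big[Num.max/0]_(j < k.+1) L2norm (iter j A f).

(** A Cauchy sequence of [Hinf A] has its L^2-limit in [Hinf A]; convergence
    is expressed by the Cauchy property because the seminorms of the limit only
    make sense once it is known to belong to [Hinf A]. *)
Definition Hinf_complete (A : operator) : Prop :=
  forall (F : nat -> V) (f : V),
    (forall j, Hinf A (F j)) ->
    (forall k (e : R), 0 < e -> exists N : nat, forall i j,
       (N <= i)%N -> (N <= j)%N -> Hnorm A k (F i - F j) < e) ->
    (L2norm (F j - f) @[j --> \oo] --> (0 : R)) ->
    Hinf A f.

Definition resolvent_set (A : operator) : set R[i] :=
  [set z | (forall g, exists! f, dom A f /\ A f - z *: f = g) /\
           exists C : R, forall f, dom A f ->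
             L2norm f <= C * L2norm (A f - z *: f)].

Definition spectrum (A : operator) : set R[i] := ~` resolvent_set A.

End L2_hilbert.

Section lattice_systems.
Context d (T : measurableType d) (R : realType)
  (mu : {measure set T -> \bar R}) (K : nat).
Local Notation V := (L2space mu).

Definition lattice_norm (xi : 'rV[int]_K) : R :=
  Num.sqrt (\sum_(i < K) (xi ord0 i)%:~R ^+ 2).

(** [f = \sum_(xi in I) c xi u xi] in L^2, where the terms are summed by
    increasing [lattice_norm]; the partial sums are finite. *)
Definition expansion (I : set 'rV[int]_K) (u : 'rV[int]_K -> V)
    (c : 'rV[int]_K -> R[i]) (f : V) : Prop :=
  L2norm (\sum_(xi \in I `&` [set xi | lattice_norm xi <= N%:R]) c xi *: u xi
          - f) @[N --> \oo] --> (0 : R).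

Definition basis (I : set 'rV[int]_K) (u : 'rV[int]_K -> V) : Prop :=
  forall f, exists2 c, expansion I u c f &
    forall c', expansion I u c' f -> {in I, c' =1 c}.

(** The families [lambda], [u] and [v] are only relevant on the index set [I]. *)
Record eigensystem (L : operator mu) (I : set 'rV[int]_K)
    (lambda : 'rV[int]_K -> R[i]) (u v : 'rV[int]_K -> V) : Prop := {
  es_spectrum : spectrum L = lambda @` I;
  es_infty : forall B : R, exists r : R, forall xi, I xi ->
    r <= lattice_norm xi -> B <= Normc.normc (lambda xi);
  es_order : forall j k, I j -> I k -> lattice_norm j <= lattice_norm k ->
    Normc.normc (lambda j) <= Normc.normc (lambda k);
  es_eigen : forall xi, I xi -> dom L (u xi) /\ L (u xi) = lambda xi *: u xi;
  es_adjoint_eigen : forall xi, I xi -> dom (adjoint L) (v xi) /\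
    adjoint L (v xi) = conjc (lambda xi) *: v xi;
  es_biorthogonal : forall xi eta, I xi -> I eta ->
    inner (u xi) (v eta) = (xi == eta)%:R;
  es_normed : forall xi, I xi -> L2norm (u xi) = 1 /\ L2norm (v xi) = 1;
  es_basis : basis I u }.

Definition weight (m : nat) (lambda : 'rV[int]_K -> R[i]) (xi : 'rV[int]_K) : R :=
  (1 + Normc.normc (lambda xi) ^+ 2) `^ (2 * m%:R)^-1.

Definition Fourier (v : 'rV[int]_K -> V) (f : V) (xi : 'rV[int]_K) : R[i] :=
  inner f (v xi).

(** [P] is only relevant on [Hinf L]. *)
Record fourier_multiplier (L : operator mu) (I : set 'rV[int]_K)
    (v : 'rV[int]_K -> V) (P : V -> V) (sigma : 'rV[int]_K -> R[i]) : Prop := {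
  fm_stable : forall f, Hinf L f -> Hinf L (P f);
  fm_linear : forall a f g, Hinf L f -> Hinf L g ->
    P (a *: f + g) = a *: P f + P g;
  fm_continuous : forall f, Hinf L f -> forall k (e : R), 0 < e ->
    exists N, exists2 del : R, 0 < del & forall g, Hinf L g ->
      Hnorm L N (g - f) < del -> Hnorm L k (P g - P f) < e;
  fm_symbol : forall f, Hinf L f -> forall xi, I xi ->
    Fourier v (P f) xi = sigma xi * Fourier v f xi }.

(** The formulas [w^(xi) = <w, conj (v xi)>] and
    [<A w, phi> = <w, conj (A^* (conj phi))>] evaluate distributions at complex
    conjugates of elements of [Hinf (adjoint L)]: the test functions [phi] are
    those for which [conj phi] is in [Hinf (adjoint L)], with the seminorms of
    [conj phi].  This is [Hinf (adjoint L)] itself whenever that space is stable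
    by conjugation. *)
Definition dist_test (L : operator mu) : set V :=
  [set phi | Hinf (adjoint L) (L2conj phi)].

(** An L-distribution is a function [V -> R[i]] that is only relevant on
    [dist_test L], where it is linear and continuous. *)
Record distribution (L : operator mu) (w : V -> R[i]) : Prop := {
  dist_linear : forall a phi psi, dist_test L phi -> dist_test L psi ->
    w (a *: phi + psi) = a * w phi + w psi;
  dist_continuous : forall phi, dist_test L phi -> forall e : R, 0 < e ->
    exists N, exists2 del : R, 0 < del & forall psi, dist_test L psi ->
      Hnorm (adjoint L) N (L2conj (psi - phi)) < del ->
      Normc.normc (w psi - w phi) < e }.

Definition dist_eq (L : operator mu) (w w' : V -> R[i]) : Prop :=
  {in dist_test L, w =1 w'}.

Definition dist_Fourier (v : 'rV[int]_K -> V) (w : V -> R[i]) (xi : 'rV[int]_K) :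
  R[i] := w (L2conj (v xi)).

Definition dist_extension (L : operator mu) (P : V -> V) (w : V -> R[i]) :
    V -> R[i] :=
  fun phi => w (L2conj (adjoint (Operator (Hinf L) P) (L2conj phi))).

Definition admissible (L : operator mu) (I : set 'rV[int]_K)
    (v : 'rV[int]_K -> V) (sigma : 'rV[int]_K -> R[i]) : set (V -> R[i]) :=
  [set f | distribution L f /\
     forall xi, I xi -> sigma xi = 0 -> dist_Fourier v f xi = 0].

Definition globally_solvable (L : operator mu) (I : set 'rV[int]_K)
    (v : 'rV[int]_K -> V) (P : V -> V) (sigma : 'rV[int]_K -> R[i]) : Prop :=
  forall f, admissible L I v sigma f ->
    exists2 w, distribution L w & dist_eq L (dist_extension L P w) f.

End lattice_systems.

Section differential_operator.
Context (R : realType) (n : nat) (Omega : set 'rV[R]_n) (oOmega : open Omega).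

Definition lebesgue_on : set 'rV[R]_n -> \bar R :=
  mrestr (@lebesgue_rV R n) (open_measurable_rV oOmega).

HB.instance Definition _ := Measure.on lebesgue_on.

Definition cpartial (i : 'I_n) (f : 'rV[R]_n -> R[i]) (x : 'rV[R]_n) : R[i] :=
  Complex ('D_(delta_mx ord0 i) (fun y => complex.Re (f y)) x)
          ('D_(delta_mx ord0 i) (fun y => complex.Im (f y)) x).

(** C^oo on the open set [O]: all iterated partial derivatives exist and are
    continuous at the points of [O]. *)
Definition smooth_on (O : set 'rV[R]_n) (f : 'rV[R]_n -> R[i]) : Prop :=
  forall (s : seq 'I_n) (x : 'rV[R]_n), O x ->
    let g := foldr cpartial f s in
    [/\ {for x, continuous (fun y => complex.Re (g y))},
        {for x, continuous (fun y => complex.Im (g y))},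
        forall i, derivable (fun y => complex.Re (g y)) x (delta_mx ord0 i) &
        forall i, derivable (fun y => complex.Im (g y)) x (delta_mx ord0 i)].

Definition test_function (phi : 'rV[R]_n -> R[i]) : Prop :=
  smooth_on setT phi /\
  exists2 C, compact C & C `<=` Omega /\ forall x, ~ C x -> phi x = 0.

Definition multiindex (m : nat) := {ffun 'I_n -> 'I_m.+1}.

Definition mdeg m (alpha : multiindex m) : nat := \sum_(i < n) alpha i.

Definition mpartial m (alpha : multiindex m) (f : 'rV[R]_n -> R[i]) :=
  foldr (fun i g => iter (alpha i) (cpartial i) g) f (enum 'I_n).

(** The coefficients of a differential operator of order exactly [m]; only the
    [a alpha] with [mdeg alpha <= m] are relevant. *)
Definition diff_coeffs m (a : multiindex m -> 'rV[R]_n -> R[i]) : Prop :=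
  (forall alpha, (mdeg alpha <= m)%N -> smooth_on Omega (a alpha)) /\
  exists alpha, mdeg alpha = m /\ exists2 x, Omega x & a alpha x != 0.

(** [\sum_(|alpha| <= m) a_alpha D^alpha f = g] in the sense of (ordinary)
    distributions on [Omega]. *)
Definition weak_diff m (a : multiindex m -> 'rV[R]_n -> R[i])
    (f g : L2space lebesgue_on) : Prop :=
  forall phi, test_function phi ->
    cintegral lebesgue_on (fun x => L2repr g x * phi x) =
    \sum_(alpha : multiindex m | (mdeg alpha <= m)%N)
      (-1) ^+ mdeg alpha * cintegral lebesgue_on
        (fun x => L2repr f x * mpartial alpha (fun y => a alpha y * phi y) x).

Definition linear_space (B : set (L2space lebesgue_on)) : Prop :=
  B 0 /\ forall (c : R[i]) f g, B f -> B g -> B (c *: f + g).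

(** The operator with boundary conditions [BC], the latter being given by the
    set of functions which satisfy them.  [weak_diff a f] determines at most one
    element of L^2. *)
Definition diff_operator m (a : multiindex m -> 'rV[R]_n -> R[i])
    (BC : set (L2space lebesgue_on)) : operator lebesgue_on :=
  Operator [set f | BC f /\ exists g, weak_diff a f g]
           (fun f => xget 0 [set g | weak_diff a f g]).

End differential_operator.

(* Main.v *)
Require Import Defs.
From mathcomp Require Import all_boot all_order all_algebra complex.
From mathcomp Require Import all_classical all_reals all_analysis.
From mathcomp Require Import measurable_realfun ring lra.
Import Order.TTheory GRing.Theory Num.Theory numFieldNormedType.Exports.
Local Open Scope classical_set_scope.
Local Open Scope ring_scope.
Set Implicit Arguments. Unset Strict Implicit. Unset Printing Implicit Defensive.

(** Two vectors of norm one whose inner product is 1 are equal, by the equality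
    case of Cauchy-Schwarz.  The normalisation of the biorthogonal systems
    therefore forces [u = v] on the index set ([eigensystem_eq]), so that the
    eigenfunctions form an orthonormal basis and everything can be read off the
    Fourier coefficients, square-summable families corresponding to elements
    of L^2 ([riesz_fischer], which rests on [L2_complete]).

    Both [L] and its adjoint act diagonally on the coefficients, by [lambda] and
    by its conjugate, and they do so with the largest possible domain: [f] is in
    the domain as soon as the multiplied coefficients are those of an element
    of L^2.  For the adjoint this is Parseval; for [L] it follows from the
    existence of a point of the resolvent set ([eigensystem_diagonal]).  Hence a
    test function is a vector all of whose coefficient families
    [lambda ^ k * f^] are square-summable, and multiplication of the
    coefficients by a symbol of polynomial growth in [lambda] is a continuous
    operation on test functions ([Hinf_multiplier], [Hnorm_multiplier]).  The
    basis being orthonormal, domination of the coefficients is enough for this.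

    If the symbol satisfies the lower bound, its inverse, taken to be 0 where
    the symbol vanishes, has polynomial growth; the finitely many indices with
    [lambda xi = 0] only affect the constant.  Then [P w = f] is solved by
    transposing the division by the conjugate symbol.  The composite of this
    division with the adjoint of [P] removes the coefficients at the zeros of
    the symbol, which an admissible [f] does not see ([dist_vanish]).

    Conversely, suppose that no exponent works and pick indices [x k] with
    [0 < |sigma (x k)| <= weight ^ -(k + 1)].  Only finitely many eigenvalues lie
    in a bounded region and each index can occur only finitely often, so the
    weights at [x k] are eventually at least 4 ([violating_sequence]).  A
    square-summable family of coefficients with values at least [2 ^ -k] at
    [x k] is an admissible distribution; a solution of [P w = f] would have the
    coefficients [2 ^ -k / |sigma (x k)|] or larger there, which exceeds every
    power of the weight, whereas the coefficients of a distribution grow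
    polynomially ([dist_Fourier_bound]). *)

(** * Integrals of complex functions and the inner product of L^2 *)

Section complex_integral.
Context d (T : measurableType d) (R : realType)
  (mu : {measure set T -> \bar R}).
Local Notation Re := complex.Re.
Local Notation Im := complex.Im.

Definition cintegrable (f : T -> R[i]) : Prop :=
  mu.-integrable setT (EFin \o (fun x => Re (f x))) /\
  mu.-integrable setT (EFin \o (fun x => Im (f x))).

Lemma ReD (x y : R[i]) : Re (x + y) = Re x + Re y.
Proof. by case: x y => [? ?] [? ?]. Qed.
Lemma ImD (x y : R[i]) : Im (x + y) = Im x + Im y.
Proof. by case: x y => [? ?] [? ?]. Qed.
Lemma ReM (x y : R[i]) : Re (x * y) = Re x * Re y - Im x * Im y.
Proof. by case: x y => [? ?] [? ?]. Qed.
Lemma ImM (x y : R[i]) : Im (x * y) = Re x * Im y + Im x * Re y.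
Proof. by case: x y => [? ?] [? ?]. Qed.
Lemma ReJ (x : R[i]) : Re (conjc x) = Re x.
Proof. by case: x. Qed.
Lemma ImJ (x : R[i]) : Im (conjc x) = - Im x.
Proof. by case: x. Qed.
Lemma complex_ext (x y : R[i]) : Re x = Re y -> Im x = Im y -> x = y.
Proof. by case: x y => [? ?] [? ?] /= -> ->. Qed.

(** Sums of squares stay polynomial in the real and imaginary parts, which keeps
    estimates free of square roots. *)
Definition abs2 (x : R[i]) : R := Re x ^+ 2 + Im x ^+ 2.

Lemma normc_sqr (x : R[i]) : Normc.normc x ^+ 2 = abs2 x.
Proof. by case: x => x y /=; rewrite sqr_sqrtr// addr_ge0 ?sqr_ge0. Qed.
Lemma abs2_ge0 (x : R[i]) : 0 <= abs2 x.
Proof. by rewrite addr_ge0 ?sqr_ge0. Qed.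
Lemma abs2_eq0 (x : R[i]) : abs2 x = 0 -> x = 0.
Proof.
move=> /eqP; rewrite paddr_eq0 ?sqr_ge0// !sqrf_eq0.
by case: x => a b /= /andP[/eqP-> /eqP->].
Qed.
Lemma abs20 : abs2 0 = 0. Proof. by rewrite /abs2 /= expr0n addr0. Qed.
Lemma abs2M (x y : R[i]) : abs2 (x * y) = abs2 x * abs2 y.
Proof. by rewrite /abs2 ReM ImM; ring. Qed.
Lemma abs2J (x : R[i]) : abs2 (conjc x) = abs2 x.
Proof. by rewrite /abs2 ReJ ImJ sqrrN. Qed.
Lemma abs2N (x : R[i]) : abs2 (- x) = abs2 x.
Proof. by rewrite /abs2; case: x => a b /=; rewrite !sqrrN. Qed.
Lemma abs2_paral (x y : R[i]) : abs2 (x + y) <= 2 * abs2 x + 2 * abs2 y.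
Proof.
rewrite -subr_ge0 /abs2 ReD ImD.
rewrite (_ : _ - _ = (Re x - Re y) ^+ 2 + (Im x - Im y) ^+ 2); last by ring.
by rewrite addr_ge0 ?sqr_ge0.
Qed.
Lemma mulJc (x : R[i]) : x * conjc x = Complex (abs2 x) 0.
Proof. by case: x => a b; apply: complex_ext; rewrite /abs2 /=; ring. Qed.
Lemma abs2X (x : R[i]) j : abs2 (x ^+ j) = abs2 x ^+ j.
Proof.
elim: j => [|j IH]; last by rewrite !exprS abs2M IH.
by rewrite /abs2 /= expr0n expr1n addr0.
Qed.
Lemma abs2_gt0 (x : R[i]) : x != 0 -> 0 < abs2 x.
Proof.
by move=> x0; rewrite lt_def abs2_ge0 andbT; apply: contra x0 => /eqP/abs2_eq0->.
Qed.
Lemma abs2V (x : R[i]) : x != 0 -> abs2 x^-1 = (abs2 x)^-1.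
Proof.
move=> x0; have a0 := abs2_gt0 x0.
by apply: (mulfI (lt0r_neq0 a0)); rewrite mulfV ?gt_eqF// -abs2M mulfV// /abs2 /=;
  rewrite expr0n expr1n addr0.
Qed.
Lemma normc_sqr_lt (x : R[i]) (r : R) : 0 < r ->
  (Normc.normc x < r) = (abs2 x < r ^+ 2).
Proof.
move=> r0; rewrite -normc_sqr ltr_pXn2r ?nnegrE ?(ltW r0)//.
by case: x => a b; exact: sqrtr_ge0.
Qed.
Lemma normc_small_eq0 (x : R[i]) : (forall r : R, 0 < r -> Normc.normc x < r) -> x = 0.
Proof.
move=> xr; apply/abs2_eq0/eqP; rewrite eq_le abs2_ge0 andbT leNgt.
apply/negP => x0; have s0 : 0 < Num.sqrt (abs2 x) by rewrite sqrtr_gt0.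
by have := xr _ s0; rewrite normc_sqr_lt// sqr_sqrtr ?abs2_ge0// ltxx.
Qed.

Lemma conjcD (x y : R[i]) : conjc (x + y) = conjc x + conjc y.
Proof. exact: rmorphD. Qed.
Lemma conjcM (x y : R[i]) : conjc (x * y) = conjc x * conjc y.
Proof. exact: rmorphM. Qed.
Lemma conjcN (x : R[i]) : conjc (- x) = - conjc x.
Proof. exact: rmorphN. Qed.

Lemma integrableDr (f g : T -> R) :
  mu.-integrable setT (EFin \o f) -> mu.-integrable setT (EFin \o g) ->
  mu.-integrable setT (EFin \o (fun x => f x + g x)).
Proof. by move=> fi gi; exact: (integrableD measurableT fi gi). Qed.

Lemma integrableZr (r : R) (f : T -> R) :
  mu.-integrable setT (EFin \o f) ->
  mu.-integrable setT (EFin \o (fun x => r * f x)).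
Proof. by move=> fi; exact: (integrableZl measurableT r fi). Qed.

Lemma integrableNr (f : T -> R) :
  mu.-integrable setT (EFin \o f) ->
  mu.-integrable setT (EFin \o (fun x => - f x)).
Proof.
move=> /(integrableZr (-1)); rewrite (_ : _ \o _ = EFin \o (fun x => - f x))//.
by apply/funext => x /=; rewrite mulN1r.
Qed.

Lemma cintegralD f g : cintegrable f -> cintegrable g ->
  cintegral mu (fun x => f x + g x) = cintegral mu f + cintegral mu g.
Proof.
move=> [rf jf] [rg jg]; apply: complex_ext; rewrite ?ReD ?ImD /=.
  by under eq_Rintegral => x _ do rewrite ReD; rewrite RintegralD.
by under eq_Rintegral => x _ do rewrite ImD; rewrite RintegralD.
Qed.

Lemma cintegralZ c f : cintegrable f ->
  cintegral mu (fun x => c * f x) = c * cintegral mu f.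
Proof.
move=> [rf jf]; apply: complex_ext; rewrite ?ReM ?ImM /=.
  under eq_Rintegral => x _ do rewrite ReM.
  rewrite RintegralB ?RintegralZl//; exact: integrableZr.
under eq_Rintegral => x _ do rewrite ImM.
rewrite RintegralD ?RintegralZl//; exact: integrableZr.
Qed.

Lemma cintegral_conj f : cintegrable f ->
  cintegral mu (fun x => conjc (f x)) = conjc (cintegral mu f).
Proof.
move=> [rf jf]; apply: complex_ext; rewrite ?ReJ ?ImJ /=.
  by apply: eq_Rintegral => x _; rewrite ReJ.
under eq_Rintegral => x _ do rewrite ImJ -mulN1r.
by rewrite RintegralZl// mulN1r.
Qed.

(** The inner product is defined through chosen representatives; this is what makes
    it computable on any representatives. *)
Lemma eq_ae_cintegral f g : cintegrable f -> cintegrable g ->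
  {ae mu, forall x, f x = g x} -> cintegral mu f = cintegral mu g.
Proof.
move=> [rf jf] [rg jg] fg; congr Complex; congr fine.
  apply: ae_eq_integral => //; [exact: measurable_int rf|exact: measurable_int rg|].
  by apply: filterS fg => x /= ->.
apply: ae_eq_integral => //; [exact: measurable_int jf|exact: measurable_int jg|].
by apply: filterS fg => x /= ->.
Qed.

Lemma Lfun2_mul_integrable (f g : T -> R) :
  f \in Lfun mu 2%:E -> g \in Lfun mu 2%:E ->
  mu.-integrable setT (EFin \o (fun x => f x * g x)).
Proof. by move=> lf lg; apply/Lfun1_integrable; exact: Lfun2_mul_Lfun1. Qed.

Lemma L2fun_mulJ_integrable (f g : L2fun mu) :
  cintegrable (fun x => f x * conjc (g x)).
Proof.
have /andP[rf jf] := L2fun_valP f; have /andP[rg jg] := L2fun_valP g.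
split.
  rewrite (_ : (fun x => _) = fun x => Re (f x) * Re (g x) + Im (f x) * Im (g x)).
    by apply: integrableDr; exact: Lfun2_mul_integrable.
  by apply/funext => x; rewrite ReM ReJ ImJ mulrN opprK.
rewrite (_ : (fun x => _) = fun x => Im (f x) * Re (g x) + - (Re (f x) * Im (g x))).
  by apply: integrableDr; [|apply: integrableNr]; exact: Lfun2_mul_integrable.
by apply/funext => x; rewrite ImM ReJ ImJ mulrN addrC.
Qed.

End complex_integral.

Section L2_inner_product.
Context d (T : measurableType d) (R : realType)
  (mu : {measure set T -> \bar R}).
Local Notation V := (L2space mu).
Local Notation Re := complex.Re.
Local Notation Im := complex.Im.
Implicit Types f g h : V.

Lemma L2repr_class (f : L2fun mu) :
  {ae mu, forall x, L2repr (L2class f) x = f x}.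
Proof. by apply/L2class_eq; rewrite L2reprK. Qed.

Lemma inner_class (f g : L2fun mu) :
  inner (L2class f) (L2class g) = cintegral mu (fun x => f x * conjc (g x)).
Proof.
apply: eq_ae_cintegral; [exact: L2fun_mulJ_integrable..|].
by apply: filterS2 (L2repr_class f) (L2repr_class g) => x -> ->.
Qed.

Lemma innerDl f g h : inner (f + g) h = inner f h + inner g h.
Proof.
rewrite -[f]L2reprK -[g]L2reprK -[h]L2reprK -L2classD !inner_class.
rewrite -cintegralD; [|exact: L2fun_mulJ_integrable..].
by congr cintegral; apply/funext => x; rewrite -mulrDl.
Qed.

Lemma L2class_scale c (f : L2fun mu) : L2class (c *: f) = c *: L2class f.
Proof. exact: L2classZ. Qed.

Lemma innerZl c f g : inner (c *: f) g = c * inner f g.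
Proof.
rewrite -[f]L2reprK -[g]L2reprK -L2class_scale !inner_class.
rewrite -cintegralZ; last exact: L2fun_mulJ_integrable.
by congr cintegral; apply/funext => x; rewrite mulrA.
Qed.

Lemma innerC f g : inner g f = conjc (inner f g).
Proof.
rewrite /inner -cintegral_conj; last exact: L2fun_mulJ_integrable.
by congr cintegral; apply/funext => x; rewrite conjcM conjcK mulrC.
Qed.

Lemma innerDr f g h : inner h (f + g) = inner h f + inner h g.
Proof. by rewrite innerC innerDl conjcD -!innerC. Qed.

Lemma innerZr c f g : inner f (c *: g) = conjc c * inner f g.
Proof. by rewrite innerC innerZl conjcM -!innerC. Qed.

Lemma inner0l g : inner 0 g = 0.
Proof. by rewrite -[0](scale0r 0) innerZl mul0r. Qed.

Lemma inner0r g : inner g 0 = 0.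
Proof. by rewrite innerC inner0l conjc0. Qed.

Lemma innerNl f g : inner (- f) g = - inner f g.
Proof. by rewrite -scaleN1r innerZl mulN1r. Qed.

Lemma innerBl f g h : inner (f - g) h = inner f h - inner g h.
Proof. by rewrite innerDl innerNl. Qed.

Lemma innerNr f g : inner f (- g) = - inner f g.
Proof. by rewrite innerC innerNl conjcN -innerC. Qed.

Lemma innerBr f g h : inner h (f - g) = inner h f - inner h g.
Proof. by rewrite innerDr innerNr. Qed.

Lemma inner_suml (J : Type) (s : seq J) (F : J -> V) g :
  inner (\sum_(j <- s) F j) g = \sum_(j <- s) inner (F j) g.
Proof.
elim: s => [|j s IH]; first by rewrite !big_nil inner0l.
by rewrite !big_cons innerDl IH.
Qed.

Lemma inner_sumr (J : Type) (s : seq J) (F : J -> V) g :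
  inner g (\sum_(j <- s) F j) = \sum_(j <- s) inner g (F j).
Proof.
elim: s => [|j s IH]; first by rewrite !big_nil inner0r.
by rewrite !big_cons innerDr IH.
Qed.

Definition sqnorm f : R := Re (inner f f).

Definition csq (f : T -> R[i]) (x : T) : R := abs2 (f x).

Lemma sqnorm_class (f : L2fun mu) :
  sqnorm (L2class f) = \int[mu]_x csq f x.
Proof.
rewrite /sqnorm inner_class /=; apply: eq_Rintegral => x _.
by rewrite ReM ReJ ImJ mulrN opprK -!expr2.
Qed.

Lemma csq_ge0 (f : T -> R[i]) x : 0 <= csq f x.
Proof. exact: abs2_ge0. Qed.

Lemma csq_eq0 (f : T -> R[i]) x : csq f x = 0 -> f x = 0.
Proof.
exact: abs2_eq0.
Qed.

Lemma csq_integrable (f : L2fun mu) : mu.-integrable setT (EFin \o csq f).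
Proof.
have /andP[rf jf] := L2fun_valP f.
by apply: integrableDr; exact: Lfun2_integrable_sqr.
Qed.

Lemma sqnorm_classE (f : L2fun mu) :
  ((sqnorm (L2class f))%:E = \int[mu]_x (csq f x)%:E)%E.
Proof.
rewrite sqnorm_class fineK//; apply: integrable_fin_num => //.
exact: csq_integrable.
Qed.

Lemma sqnorm_ge0 f : 0 <= sqnorm f.
Proof.
by rewrite -[f]L2reprK sqnorm_class Rintegral_ge0// => x _; exact: csq_ge0.
Qed.

Lemma inner_self f : inner f f = Complex (sqnorm f) 0.
Proof.
apply: complex_ext; first by [].
rewrite [RHS]/=; have := congr1 (@complex.Im R) (innerC f f).
by rewrite ImJ => ?; lra.
Qed.

Lemma sqnorm_eq0 f : sqnorm f = 0 -> f = 0.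
Proof.
move=> f0; rewrite -[f]L2reprK.
have -> : (0 : V) = L2class 0.
  by apply: (addIr (L2class 0)); rewrite add0r -L2classD addr0.
apply/L2class_eq.
have : (\int[mu]_x `|(csq (L2repr f) x)%:E| = 0)%E.
  under eq_integral => x _ do rewrite gee0_abs ?lee_fin ?csq_ge0//.
  by rewrite -sqnorm_classE L2reprK f0.
have mf := measurable_int mu (csq_integrable (L2repr f)).
move/(ae_eq_integral_abs mu measurableT mf).
apply: filterS => x /(_ I) [] /csq_eq0 ->.
by [].
Qed.

Lemma sqnormZ c f : sqnorm (c *: f) = abs2 c * sqnorm f.
Proof.
rewrite /sqnorm innerZl innerZr mulrA.
by rewrite inner_self ReM mulr0 subr0 mulJc.
Qed.

Lemma sqnormN f : sqnorm (- f) = sqnorm f.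
Proof. by rewrite /sqnorm innerNl innerNr opprK. Qed.

Lemma sqr_L2norm f : L2norm f ^+ 2 = sqnorm f.
Proof. by rewrite sqr_sqrtr// sqnorm_ge0. Qed.

Lemma L2norm_ge0 f : 0 <= L2norm f.
Proof. exact: sqrtr_ge0. Qed.

End L2_inner_product.

(** * Completeness of L^2 *)

(** Comparison of the telescoping series with a geometric one. *)
Lemma geometric_increments_cvg (R : realType) (u : R^nat) (C : R) :
  (forall k, `|u k.+1 - u k| <= C * 2^-1 ^+ k) -> cvgn u.
Proof.
move=> uC.
have : cvgn [normed series (telescope u)].
  apply: (@series_le_cvg _ _ (geometric C 2^-1)) => [n|n|n|].
  - exact: normr_ge0.
  - by apply: le_trans (uC n); exact: normr_ge0.
  - exact: uC.
  - by apply: is_cvg_geometric_series; rewrite ger0_norm; lra.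
move=> /normed_cvg cu.
rewrite (_ : u = (fun n => u 0%N + series (telescope u) n)); last first.
  by apply/funext => n; exact: eq_sum_telescope.
by apply: is_cvgD => //; exact: is_cvg_cst.
Qed.

Section Lfun2.
Context d (T : measurableType d) (R : realType)
  (mu : {measure set T -> \bar R}).
Local Notation Re := complex.Re.
Local Notation Im := complex.Im.

Lemma Lfun2_measurable (f : T -> R) : f \in Lfun mu 2%:E -> measurable_fun setT f.
Proof. by rewrite inE => /andP[]; rewrite inE. Qed.

Lemma Lfun2P (f : T -> R) : measurable_fun setT f ->
  (\int[mu]_x (f x ^+ 2)%:E < +oo)%E -> f \in Lfun mu 2%:E.
Proof.
move=> mf foo; rewrite inE; apply/andP; split; first by rewrite inE.
rewrite inE /= /finite_norm unlock /Lnorm poweR_lty//.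
under eq_integral => x _ do
  rewrite poweR_EFin powR_mulrn ?normr_ge0// real_normK ?num_real//.
by [].
Qed.

End Lfun2.

Section completeness.
Context d (T : measurableType d) (R : realType)
  (mu : {measure set T -> \bar R}).
Local Notation V := (L2space mu).
Local Notation Re := complex.Re.
Local Notation Im := complex.Im.

Lemma L2classB (f g : L2fun mu) : L2class (f - g) = L2class f - L2class g.
Proof. by rewrite L2classD -scaleN1r L2class_scale scaleN1r. Qed.

Lemma sqnormB_repr (f g : V) :
  ((sqnorm (f - g))%:E =
   \int[mu]_x (csq (fun x => (L2repr f x - L2repr g x)%R) x)%:E)%E.
Proof.
rewrite -{1}[f]L2reprK -{1}[g]L2reprK -L2classB sqnorm_classE.
by apply: eq_integral.
Qed.

Lemma measurable_ReL2 (f : L2fun mu) : measurable_fun setT (fun x => Re (f x)).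
Proof. by have /andP[+ _] := L2fun_valP f; exact: Lfun2_measurable. Qed.

Lemma measurable_ImL2 (f : L2fun mu) : measurable_fun setT (fun x => Im (f x)).
Proof. by have /andP[_ +] := L2fun_valP f; exact: Lfun2_measurable. Qed.

Lemma measurable_csq (f : T -> R[i]) : measurable_fun setT (fun x => Re (f x)) ->
  measurable_fun setT (fun x => Im (f x)) -> measurable_fun setT (csq f).
Proof. by move=> mr mi; apply: measurable_funD; exact: measurable_funX. Qed.

Lemma csqB (f g : T -> R[i]) x : csq (fun x => f x - g x) x =
  (Re (f x) - Re (g x)) ^+ 2 + (Im (f x) - Im (g x)) ^+ 2.
Proof. by rewrite /csq; case: (f x) (g x) => [? ?] [? ?]. Qed.

Lemma measurable_csqB (f g : L2fun mu) :
  measurable_fun setT (csq (fun x => f x - g x)).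
Proof.
rewrite (_ : csq _ = fun x =>
  (Re (f x) - Re (g x)) ^+ 2 + (Im (f x) - Im (g x)) ^+ 2); last first.
  by apply/funext => x; exact: csqB.
by apply: measurable_funD; apply: measurable_funX; apply: measurable_funB;
  [exact: measurable_ReL2..|exact: measurable_ImL2|exact: measurable_ImL2].
Qed.

Section limit.
Variable G : nat -> V.
Hypothesis fastG : forall k, sqnorm (G k.+1 - G k) <= 8^-1 ^+ k.
Local Notation g := (fun k => L2repr (G k)).

Let incr (k : nat) (x : T) : R :=
  4 ^+ k * csq (fun x => g k.+1 x - g k x) x.

Let incr_ge0 k x : 0 <= incr k x.
Proof. by rewrite mulr_ge0 ?csq_ge0// exprn_ge0. Qed.

Let mincr k : measurable_fun setT (EFin \o incr k).
Proof.
apply/measurable_EFinP; apply: measurable_funM; first exact: measurable_cst.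
exact: measurable_csqB.
Qed.

Let tot x : \bar R := (\sum_(k <oo) (incr k x)%:E)%E.

Let mtot : measurable_fun setT tot.
Proof.
apply: (ge0_emeasurable_sum (P := xpredT)) => [k x _ _|k _].
  by rewrite lee_fin.
exact: mincr.
Qed.

Let tot_integrable : mu.-integrable setT tot.
Proof.
apply/integrableP; split; first exact: mtot.
have tot0 x : (0 <= tot x)%E by apply: nneseries_ge0 => k _ _; rewrite lee_fin.
under eq_integral => x _ do rewrite gee0_abs//.
rewrite integral_nneseries//; last by move=> k x _; rewrite lee_fin.
apply: (@le_lt_trans _ _ (\sum_(k <oo) (2^-1 ^+ k : R)%:E)%E).
  apply: lee_nneseries => k _.
    by move=> _; apply: integral_ge0 => x _; rewrite lee_fin.
  under eq_integral => x _ do rewrite /incr EFinM.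
  rewrite ge0_integralZl//.
  - rewrite -sqnormB_repr -EFinM lee_fin.
    apply: (@le_trans _ _ (4 ^+ k * 8^-1 ^+ k)).
      by rewrite ler_wpM2l ?exprn_ge0.
    by rewrite -exprMn; apply: lerXn2r; rewrite ?nnegrE; lra.
  - by apply/measurable_EFinP; exact: measurable_csqB.
  - by move=> x _; rewrite lee_fin csq_ge0.
rewrite (_ : (fun k => _) = EFin \o series (geometric 1 2^-1)); last first.
  apply/funext => k /=; rewrite sumEFin; congr EFin.
  by rewrite /series/= big_mkord big_mkord; apply: eq_bigr => j _; rewrite mul1r.
rewrite EFin_lim ?ltry//.
by apply: is_cvg_geometric_series; rewrite ger0_norm; lra.
Qed.

Let E := [set x | tot x \is a fin_num].

Let mE : measurable E.
Proof.
have := emeasurable_fin_num measurableT mtot.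
by rewrite setTI.
Qed.

Let aeE : {ae mu, forall x, E x}.
Proof. by apply: filterS (integrable_ae measurableT tot_integrable) => x; exact. Qed.

Let incr_bound x : E x -> exists2 C : R, 0 <= C &
  forall k, csq (fun x => g k.+1 x - g k x) x <= (C * 2^-1 ^+ k) ^+ 2.
Proof.
move=> Ex; have t0 : 0 <= fine (tot x).
  by apply: fine_ge0; apply: nneseries_ge0 => k _ _; rewrite lee_fin.
exists (Num.sqrt (fine (tot x))); first exact: sqrtr_ge0.
move=> k; rewrite exprMn sqr_sqrtr//.
have : incr k x <= fine (tot x).
  rewrite -lee_fin fineK//.
  apply: le_trans (@nneseries_lim_ge R (fun k => (incr k x)%:E) xpredT 0 k.+1 _).
    by rewrite big_nat_recr//= leeDr// sume_ge0// => i _; rewrite lee_fin.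
  by move=> i _ _; rewrite lee_fin.
rewrite /incr -ler_pdivlMl ?exprn_gt0//.
move=> /le_trans; apply; rewrite mulrC -exprM mulnC exprM -exprVn.
by rewrite (_ : 4^-1 = 2^-1 ^+ 2 :> R)//; lra.
Qed.

(* Cutting off outside [E] gives a sequence that converges everywhere, so that its
   limit is measurable. *)
Let gE (p : R[i] -> R) k x := p (g k x) * \1_E x.

Let gE_cvg (p : R[i] -> R) :
  (forall y z : R[i], (p y - p z) ^+ 2 <=
     (Re y - Re z) ^+ 2 + (Im y - Im z) ^+ 2) ->
  forall x, cvgn (fun k => gE p k x).
Proof.
move=> pB x; have [Ex|nEx] := pselect (E x); last first.
  rewrite (_ : (fun k => _) = cst 0); first exact: is_cvg_cst.
  by apply/funext => k; rewrite /gE indicE memNset// mulr0.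
have [C C0 HC] := incr_bound Ex.
apply: (@geometric_increments_cvg _ _ C) => k.
rewrite /gE indicE mem_set// !mulr1.
have := le_trans (pB (g k.+1 x) (g k x)) (_ : _ <= (C * 2^-1 ^+ k) ^+ 2).
rewrite -csqB => /(_ (HC k)).
by rewrite -[leLHS]real_normK ?num_real// ler_sqr// nnegrE mulr_ge0 ?exprn_ge0.
Qed.

Let RegE_cvg x : cvgn (fun k => gE (@complex.Re R) k x).
Proof. by apply: gE_cvg => y z; rewrite lerDl sqr_ge0. Qed.

Let ImgE_cvg x : cvgn (fun k => gE (@complex.Im R) k x).
Proof. by apply: gE_cvg => y z; rewrite lerDr sqr_ge0. Qed.

Let lim_re x := limn (fun k => gE (@complex.Re R) k x).
Let lim_im x := limn (fun k => gE (@complex.Im R) k x).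

Let mlim_re : measurable_fun setT lim_re.
Proof.
apply: (@measurable_fun_cvg _ _ _ _ (fun k x => gE (@complex.Re R) k x)) => [k|x _].
  by apply: measurable_funM; [exact: measurable_ReL2|exact: measurable_indic].
exact: RegE_cvg.
Qed.

Let mlim_im : measurable_fun setT lim_im.
Proof.
apply: (@measurable_fun_cvg _ _ _ _ (fun k x => gE (@complex.Im R) k x)) => [k|x _].
  by apply: measurable_funM; [exact: measurable_ImL2|exact: measurable_indic].
exact: ImgE_cvg.
Qed.

Let glim x : R[i] := Complex (lim_re x) (lim_im x).

Let fatou_bound (f : V) (B : R) J :
  (forall j, (J <= j)%N -> sqnorm (f - G j) <= B) ->
  (\int[mu]_x (csq (fun x => (L2repr f x - glim x)%R) x)%:E <= B%:E)%E.
Proof.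
move=> fB.
pose h j x := (csq (fun x => (L2repr f x - g (j + J)%N x)%R) x)%:E.
have := @fatou _ _ _ mu setT measurableT h.
move=> /(_ _ _)/le_trans Hf.
apply: (@le_trans _ _ (\int[mu]_x limn_einf (h^~ x))%E); last first.
  apply: Hf => [j|j x _|].
  - by apply/measurable_EFinP; exact: measurable_csqB.
  - by rewrite lee_fin csq_ge0.
  - rewrite limn_einf_lim; apply: lime_le; first exact: is_cvg_einfs.
    apply: nearW => n; apply: ge_ereal_inf; exists (\int[mu]_x h n x)%E.
      by exists n => //=.
    by rewrite -sqnormB_repr lee_fin fB// leq_addl.
apply: ae_ge0_le_integral => //.
- by move=> x _; rewrite lee_fin csq_ge0.
- apply/measurable_EFinP.
  rewrite (_ : csq _ = fun x => (Re (L2repr f x) - lim_re x) ^+ 2 +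
     (Im (L2repr f x) - lim_im x) ^+ 2); last by apply/funext => x; exact: csqB.
  by apply: measurable_funD; apply: measurable_funX; apply: measurable_funB => //;
    [exact: measurable_ReL2|exact: measurable_ImL2].
- move=> x _; rewrite limn_einf_lim; apply: lime_ge; first exact: is_cvg_einfs.
  apply: nearW => n; apply: le_ereal_inf_tmp => _ [k _ <-].
  by rewrite lee_fin csq_ge0.
- apply: measurableT_comp => //.
  apply: (@measurable_fun_limn_esup _ _ _ _ (fun j x => - h j x)%E) => j.
  apply: measurableT_comp => //.
  by apply/measurable_EFinP; exact: measurable_csqB.
apply: filterS aeE => x Ex _.
suff : h^~ x @ \oo --> (csq (fun x => (L2repr f x - glim x)%R) x)%:E.
  by move=> /cvg_limn_einf_sup[-> _].
apply: cvg_EFin; first by apply: nearW.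
rewrite csqB /=.
have cR : (fun j => Re (g (j + J)%N x)) @ \oo --> lim_re x.
  have := @RegE_cvg x; rewrite -(cvg_shiftn J).
  by under eq_fun do rewrite /gE indicE mem_set// mulr1.
have cI : (fun j => Im (g (j + J)%N x)) @ \oo --> lim_im x.
  have := @ImgE_cvg x; rewrite -(cvg_shiftn J).
  by under eq_fun do rewrite /gE indicE mem_set// mulr1.
rewrite (_ : fine \o _ = fun j => (Re (L2repr f x) - Re (g (j + J)%N x)) ^+ 2 +
     (Im (L2repr f x) - Im (g (j + J)%N x)) ^+ 2); last first.
  by apply/funext => j /=; exact: csqB.
by apply: cvgD; rewrite expr2; under eq_fun do rewrite expr2; apply: cvgM;
  apply: cvgB => //; exact: cvg_cst.
Qed.

(** The pointwise limit exists almost everywhere because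
    [\sum_k 4 ^ k * |g_(k+1) - g_k| ^ 2] has a finite integral: where this sum is
    finite, the increments are bounded by a multiple of [2 ^ -k].  Fatou then turns
    a bound on the distances to the [G j] into a bound on the distance to the
    limit.  The conclusion is stated for an arbitrary [f] so that it applies to
    a whole sequence of which [G] is only a subsequence. *)
Lemma fast_cauchy_cvg : (exists B, forall j, sqnorm (G 0%N - G j) <= B) ->
  exists l : V, forall (f : V) B J,
    (forall j, (J <= j)%N -> sqnorm (f - G j) <= B) -> sqnorm (f - l) <= B.
Proof.
move=> [B0 G0B].
pose phi x := g 0%N x - glim x.
have phioo : (\int[mu]_x (csq phi x)%:E < +oo)%E.
  apply: le_lt_trans (ltry B0); apply: (@fatou_bound _ _ 0%N) => j _; exact: G0B.
have mr : measurable_fun setT (fun x => Re (phi x)).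
  rewrite (_ : (fun x => _) = fun x => Re (g 0%N x) - lim_re x); last first.
    by apply/funext => x; rewrite /phi; case: (g 0%N x).
  by apply: measurable_funB => //; exact: measurable_ReL2.
have mi : measurable_fun setT (fun x => Im (phi x)).
  rewrite (_ : (fun x => _) = fun x => Im (g 0%N x) - lim_im x); last first.
    by apply/funext => x; rewrite /phi; case: (g 0%N x).
  by apply: measurable_funB => //; exact: measurable_ImL2.
have mcsq : measurable_fun setT (EFin \o csq phi).
  by apply/measurable_EFinP; exact: measurable_csq.
have L2phi : phi \in square_integrable mu.
  apply/andP; split; apply: Lfun2P => //; apply: le_lt_trans phioo;
    apply: ge0_le_integral => //.
  - by move=> x _; rewrite lee_fin sqr_ge0.
  - by apply/measurable_EFinP; exact: measurable_funX.
  - by move=> x _; rewrite lee_fin lerDl sqr_ge0.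
  - by move=> x _; rewrite lee_fin sqr_ge0.
  - by apply/measurable_EFinP; exact: measurable_funX.
  - by move=> x _; rewrite lee_fin lerDr sqr_ge0.
exists (L2class (g 0%N - MkL2fun L2phi)) => f B J fB.
rewrite -lee_fin -[f]L2reprK -L2classB sqnorm_classE.
apply: le_trans (fatou_bound fB); rewrite le_eqVlt; apply/orP; left; apply/eqP.
apply: eq_integral => x _; congr (_ %:E); rewrite /csq.
suff -> : (L2repr f - (g 0%N - MkL2fun L2phi)) x = L2repr f x - glim x by [].
rewrite -[LHS]/(L2repr f x - (g 0%N x - (g 0%N x - glim x))).
by rewrite subKr.
Qed.

End limit.

(** Completeness (Riesz-Fischer), deduced from the case of a subsequence with
    geometric rate [8 ^ -k]. *)
Lemma L2_complete (F : nat -> V) :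
  (forall e : R, 0 < e -> exists N, forall i j, (N <= i)%N -> (N <= j)%N ->
    sqnorm (F i - F j) <= e) ->
  exists l, forall e : R, 0 < e -> exists N, forall i, (N <= i)%N ->
    sqnorm (F i - l) <= e.
Proof.
move=> cF.
have /choice[m mP] k : exists N, forall i j, (N <= i)%N -> (N <= j)%N ->
    sqnorm (F i - F j) <= 8^-1 ^+ k by apply: cF; rewrite exprn_gt0.
(* A subsequence with [n k >= m k], for the rate, and [n k >= k], for it to be
   cofinal. *)
pose n k := (\sum_(i < k.+1) (m i).+1)%N.
have nS k : (n k <= n k.+1)%N by rewrite /n [leqRHS]big_ord_recr leq_addr.
have mn k : (m k <= n k)%N.
  by rewrite /n big_ord_recr /= (leq_trans (leqnSn _))// leq_addl.
have kn k : (k <= n k)%N.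
  rewrite /n; apply: leq_trans (_ : (\sum_(i < k.+1) 1 <= _)%N).
    by rewrite sum_nat_const card_ord muln1.
  by apply: leq_sum.
have n0 k : (n 0%N <= n k)%N by elim: k => // k /leq_trans; apply.
have [k||l Hl] := @fast_cauchy_cvg (fun k => F (n k)).
- by apply: mP; rewrite (leq_trans (mn k)).
- exists 1 => j; rewrite -(expr0 8^-1); apply: mP; first exact: mn.
  exact: leq_trans (mn 0%N) (n0 j).
exists l => e e0; have [N NP] := cF e e0; exists N => i Ni.
by apply: (Hl _ _ N) => j Nj; apply: NP => //; exact: leq_trans Nj (kn j).
Qed.

End completeness.

(** * Orthonormal bases indexed by lattice points *)

Section lattice_ball.
Context (R : realType) (K : nat).

Lemma lattice_norm_ge (xi : 'rV[int]_K) (i : 'I_K) :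
  `|(xi ord0 i)%:~R| <= lattice_norm R xi.
Proof.
rewrite -sqrtr_sqr ler_wsqrtr// (bigD1 i)//= lerDl.
by apply: sumr_ge0 => j _; exact: sqr_ge0.
Qed.

(** Coordinates of a point of the ball are integers between [-n] and [n]. *)
Lemma lattice_ball_finite (r : R) :
  finite_set [set xi : 'rV[int]_K | lattice_norm R xi <= r].
Proof.
have [n rn] : exists n : nat, r <= n%:R.
  by exists (Num.truncn r).+1; exact/ltW/truncnS_gt.
pose F (f : {ffun 'I_K -> 'I_(n + n).+1}) : 'rV[int]_K :=
  \row_i ((f i : nat)%:Z - n%:Z).
apply: (@sub_finite_set _ _ (F @` setT)); last first.
  exact/finite_image/finite_finset.
move=> xi /= xir.
have xin i : `|xi ord0 i| <= n%:Z.
  rewrite -(ler_int R) intr_norm.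
  exact: le_trans (lattice_norm_ge xi i) (le_trans xir rn).
exists [ffun i => inord `|(xi ord0 i + n%:Z)%R|%N] => //.
apply/rowP => i; rewrite mxE ffunE.
have := xin i; rewrite ler_norml => /andP[h1 h2].
have h3 : 0 <= xi ord0 i + n by rewrite -lerBlDr sub0r.
rewrite inordK; first by rewrite gez0_abs// addrK.
by rewrite ltnS -lez_nat gez0_abs// PoszD lerD2r.
Qed.

End lattice_ball.

Section orthonormal_basis.
Context d (T : measurableType d) (R : realType)
  (mu : {measure set T -> \bar R}) (K : nat).
Local Notation V := (L2space mu).
Local Notation Z := 'rV[int]_K.
Local Notation Re := complex.Re.
Local Notation Im := complex.Im.

(** Expanding the square norm of [sqnorm g *: f - inner f g *: g] gives [sqnorm g]
    times the difference of the two sides. *)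
Lemma cauchy_schwarz (f g : V) : abs2 (inner f g) <= sqnorm f * sqnorm g.
Proof.
have [g0|g0] := eqVneq (sqnorm g) 0.
  by rewrite (sqnorm_eq0 g0) inner0r abs20 mulr_ge0 ?sqnorm_ge0.
have gp : 0 < sqnorm g by rewrite lt_def g0 sqnorm_ge0.
have := sqnorm_ge0 (Complex (sqnorm g) 0 *: f - inner f g *: g).
have -> : sqnorm (Complex (sqnorm g) 0 *: f - inner f g *: g) =
    sqnorm g * (sqnorm f * sqnorm g - abs2 (inner f g)).
  rewrite /sqnorm !(innerBl, innerBr, innerZl, innerZr) (innerC f g).
  rewrite !inner_self; case: (inner f g) => a b.
  by rewrite /abs2 /=; ring.
by rewrite pmulr_rge0// subr_ge0.
Qed.

(** The indices of the partial sums in [expansion], as a sequence. *)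
Definition index_ball (I : set Z) (n : nat) : seq Z :=
  finmap.enum_fset (fset_set (I `&` [set xi | lattice_norm R xi <= n%:R])).

Definition partial_sum (I : set Z) (e : Z -> V) (c : Z -> R[i]) n : V :=
  \sum_(xi <- index_ball I n) c xi *: e xi.

Lemma mem_index_ball (I : set Z) n xi :
  (xi \in index_ball I n) = (xi \in I) && (lattice_norm R xi <= n%:R).
Proof.
rewrite in_fset_set; last by apply/finite_setIr/lattice_ball_finite.
by apply/idP/andP; rewrite !inE.
Qed.

Lemma index_ball_uniq (I : set Z) n : uniq (index_ball I n).
Proof. exact: finmap.fset_uniq. Qed.

Lemma eventually_index_ball (I : set Z) xi : I xi ->
  exists N, forall n, (N <= n)%N -> xi \in index_ball I n.
Proof.
move=> Ixi; exists (Num.truncn (lattice_norm R xi)).+1 => n Nn.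
rewrite mem_index_ball mem_set//=.
by apply: le_trans (ltW (truncnS_gt _)) _; rewrite ler_nat.
Qed.

Lemma index_ball_mono (I : set Z) m n xi : (m <= n)%N ->
  xi \in index_ball I m -> xi \in index_ball I n.
Proof.
move=> mn; rewrite !mem_index_ball => /andP[-> /le_trans->]//.
by rewrite ler_nat.
Qed.

Lemma expansionE (I : set Z) (e : Z -> V) c f : expansion I e c f <->
  L2norm (partial_sum I e c N - f) @[N --> \oo] --> (0 : R).
Proof.
rewrite /expansion; under eq_fun => n.
  rewrite fsbig_finite; last exact/finite_setIr/lattice_ball_finite.
  over.
by [].
Qed.

Record orthonormal_basis (I : set Z) (e : Z -> V) : Prop := OrthonormalBasis {
  onb_inner : forall xi eta, I xi -> I eta -> inner (e xi) (e eta) = (xi == eta)%:R;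
  onb_basis : Defs.basis I e }.

Section theory.
Variables (I : set Z) (e : Z -> V).
Hypothesis onb : orthonormal_basis I e.
Local Notation B := (index_ball I).
Local Notation S := (partial_sum I e).
Local Notation coef := (Fourier e).

Lemma FourierE f xi : coef f xi = inner f (e xi). Proof. by []. Qed.

Lemma FourierD f g xi : coef (f + g) xi = coef f xi + coef g xi.
Proof. exact: innerDl. Qed.
Lemma FourierB f g xi : coef (f - g) xi = coef f xi - coef g xi.
Proof. exact: innerBl. Qed.
Lemma FourierZ a f xi : coef (a *: f) xi = a * coef f xi.
Proof. exact: innerZl. Qed.
Lemma Fourier0 xi : coef 0 xi = 0.
Proof. exact: inner0l. Qed.

Lemma Fourier_onb xi eta : I xi -> I eta -> coef (e xi) eta = (xi == eta)%:R.
Proof. exact: onb_inner. Qed.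

Lemma Fourier_partial_sum c n xi : I xi ->
  coef (S c n) xi = if xi \in B n then c xi else 0.
Proof.
move=> Ixi; rewrite FourierE inner_suml.
have E eta : eta \in B n -> inner (c eta *: e eta) (e xi) =
    if eta == xi then c xi else 0.
  rewrite mem_index_ball => /andP[/set_mem Ieta _].
  rewrite innerZl (onb_inner onb)//; case: eqP => [->|]; first by rewrite mulr1.
  by rewrite mulr0.
case: ifPn => xB.
  rewrite (bigD1_seq xi) ?index_ball_uniq//= E// eqxx big1_seq ?addr0//.
  by move=> eta /andP[/negPf nx /E]; rewrite nx.
rewrite big1_seq// => eta /andP[_ etaB]; rewrite E//; case: eqP => // ex.
by rewrite -ex etaB in xB.
Qed.

Lemma sqnorm_partial_sum c n :
  sqnorm (S c n) = \sum_(xi <- B n) abs2 (c xi).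
Proof.
rewrite /sqnorm {2}/partial_sum inner_sumr.
rewrite (eq_big_seq (fun xi => Complex (abs2 (c xi)) 0)); last first.
  move=> xi /[dup] xB; rewrite mem_index_ball => /andP[/set_mem Ixi _].
  by rewrite innerZr -FourierE Fourier_partial_sum// xB mulrC mulJc.
by elim: (B n) => [|x s IH]; rewrite ?big_nil// !big_cons ReD IH.
Qed.

Lemma inner_partial_sum f g n :
  inner f (S (coef g) n) = \sum_(xi <- B n) coef f xi * conjc (coef g xi).
Proof.
by rewrite inner_sumr; apply: eq_bigr => xi _; rewrite innerZr mulrC.
Qed.

Lemma sqnorm_sub_partial_sum f n :
  sqnorm (f - S (coef f) n) = sqnorm f - \sum_(xi <- B n) abs2 (coef f xi).
Proof.
rewrite {1}/sqnorm !(innerBl, innerBr) [inner (S _ _) f]innerC.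
rewrite !inner_self sqnorm_partial_sum inner_partial_sum.
have -> : \sum_(xi <- B n) coef f xi * conjc (coef f xi) =
    Complex (\sum_(xi <- B n) abs2 (coef f xi)) 0.
  elim: (B n) => [|x s IH]; first by rewrite !big_nil.
  by rewrite !big_cons IH mulJc; apply: complex_ext => /=; rewrite ?addr0.
by rewrite /=; lra.
Qed.

(** Biorthogonality identifies the coefficients of the partial sums, and
    Cauchy-Schwarz lets them pass to the limit. *)
Lemma expansion_Fourier c f xi : expansion I e c f -> I xi -> c xi = coef f xi.
Proof.
move=> /expansionE cf Ixi; apply/eqP; rewrite -subr_eq0; apply/eqP.
apply: abs2_eq0; apply/eqP; rewrite eq_le abs2_ge0 andbT.
apply/ler_addgt0Pr => r r0; rewrite add0r.
have [N xN] := eventually_index_ball Ixi.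
move: cf => /cvgr0_norm_lt /(_ (Num.sqrt r)) [|M _ MP]; first by rewrite sqrtr_gt0.
pose n := maxn N M.
have := MP n (leq_maxr _ _); rewrite /= ger0_norm ?L2norm_ge0// => /ltW.
rewrite ler_sqrt ?(ltW r0)// => /(le_trans _); apply.
have := cauchy_schwarz (S c n - f) (e xi).
rewrite [sqnorm (e xi)]/sqnorm (onb_inner onb)// eqxx mulr1.
by rewrite -FourierE FourierB Fourier_partial_sum// xN ?leq_maxl.
Qed.

Lemma partial_sum_cvg f (r : R) : 0 < r -> exists N, forall n, (N <= n)%N ->
  sqnorm (S (coef f) n - f) <= r.
Proof.
move=> r0; have [c cf _] := onb_basis onb f.
have /expansionE := cf => /cvgr0_norm_lt /(_ (Num.sqrt r)) [|N _ NP].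
  by rewrite sqrtr_gt0.
exists N => n /NP /=; rewrite ger0_norm ?L2norm_ge0// => /ltW.
rewrite ler_sqrt ?(ltW r0)//; congr (sqnorm (_ - f) <= r).
apply: eq_big_seq => xi; rewrite mem_index_ball => /andP[/set_mem Ixi _].
by rewrite (expansion_Fourier cf).
Qed.

Lemma bessel f n : \sum_(xi <- B n) abs2 (coef f xi) <= sqnorm f.
Proof. by rewrite -subr_ge0 -sqnorm_sub_partial_sum sqnorm_ge0. Qed.

Lemma abs2_Fourier_le f xi : I xi -> abs2 (coef f xi) <= sqnorm f.
Proof.
move=> Ixi; have := cauchy_schwarz f (e xi).
by rewrite [sqnorm (e xi)]/sqnorm (onb_inner onb)// eqxx mulr1.
Qed.

(** The half of Parseval's equality that uses completeness of the basis; the other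
    half is [bessel]. *)
Lemma parseval_le f (b : R) :
  (forall n, \sum_(xi <- B n) abs2 (coef f xi) <= b) -> sqnorm f <= b.
Proof.
move=> fb; apply/ler_addgt0Pr => r r0.
have [N /(_ N (leqnn N))] := partial_sum_cvg f r0.
rewrite -sqnormN opprB sqnorm_sub_partial_sum => h.
by have := fb N; lra.
Qed.

Lemma Fourier_inj f g : (forall xi, I xi -> coef f xi = coef g xi) -> f = g.
Proof.
move=> fg; apply/eqP; rewrite -subr_eq0; apply/eqP/sqnorm_eq0/eqP.
rewrite eq_le sqnorm_ge0 andbT; apply: parseval_le => n.
rewrite big1_seq// => xi /andP[_]; rewrite mem_index_ball => /andP[/set_mem Ixi _].
by rewrite FourierB fg// subrr abs20.
Qed.

Lemma sum_index_ball_mono (c : Z -> R) m n : (forall xi, 0 <= c xi) ->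
  (m <= n)%N -> \sum_(xi <- B m) c xi <= \sum_(xi <- B n) c xi.
Proof.
move=> c0 mn; rewrite [leRHS](bigID (fun xi => xi \in B m))/=.
rewrite -[X in _ <= X + _]big_filter.
rewrite [X in _ <= X + _](perm_big (B m)).
  by rewrite lerDl sumr_ge0.
apply: uniq_perm; rewrite ?filter_uniq ?index_ball_uniq// => xi.
rewrite mem_filter; apply/andP/idP => [[]//|xm]; split => //.
exact: index_ball_mono xm.
Qed.

(** The partial sums are a Cauchy sequence because their square norms are the
    nondecreasing bounded partial sums of [abs2 (c xi)]. *)
Lemma riesz_fischer c (b : R) :
  (forall n, \sum_(xi <- B n) abs2 (c xi) <= b) ->
  exists2 f, (forall xi, I xi -> coef f xi = c xi) & sqnorm f <= b.
Proof.
move=> cb; pose s n := \sum_(xi <- B n) abs2 (c xi).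
have sm m n : (m <= n)%N -> s m <= s n.
  by move=> mn; apply: sum_index_ball_mono => // xi; exact: abs2_ge0.
have SB m n : (m <= n)%N -> sqnorm (S c n - S c m) = s n - s m.
  move=> mn; have -> : S c m = S (coef (S c n)) m.
    apply: eq_big_seq => xi xm; have := xm.
    rewrite mem_index_ball => /andP[/set_mem Ixi _].
    by rewrite Fourier_partial_sum// (index_ball_mono mn xm).
  rewrite sqnorm_sub_partial_sum sqnorm_partial_sum; congr (_ - _).
  apply: eq_big_seq => xi xm; have := xm.
  rewrite mem_index_ball => /andP[/set_mem Ixi _].
  by rewrite Fourier_partial_sum// (index_ball_mono mn xm).
have [l Hl] : exists l, forall r : R, 0 < r -> exists N, forall i, (N <= i)%N ->
    sqnorm (S c i - l) <= r.
  apply: L2_complete => r r0.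
  have scv : cvgn s.
    apply: nondecreasing_is_cvgn; first by move=> m n; exact: sm.
    by exists b => _ [n _ <-]; exact: cb.
  move: (scv) => /cvgr_dist_lt /(_ r r0) [N _ NP].
  have key m n : (N <= m)%N -> (m <= n)%N -> sqnorm (S c n - S c m) <= r.
    move=> Nm mn; rewrite SB//.
    have := NP m Nm; rewrite /= ltr_norml => /andP[_].
    have : s n <= limn s.
      by apply: nondecreasing_cvgn_le => // x y; exact: sm.
    lra.
  exists N => i j Ni Nj; have [ij|/ltnW ji] := leqP i j.
    by rewrite -sqnormN opprB key.
  exact: key.
have lc xi : I xi -> coef l xi = c xi.
  move=> Ixi; apply/eqP; rewrite -subr_eq0; apply/eqP.
  apply: abs2_eq0; apply/eqP; rewrite eq_le abs2_ge0 andbT.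
  apply/ler_addgt0Pr => r r0; rewrite add0r.
  have [N xN] := eventually_index_ball Ixi.
  have [M MP] := Hl r r0.
  apply: le_trans (MP (maxn N M) (leq_maxr _ _)).
  apply: le_trans (abs2_Fourier_le _ Ixi).
  by rewrite FourierB Fourier_partial_sum// xN ?leq_maxl// -abs2N opprB.
exists l => //; apply: parseval_le => n.
apply: le_trans (cb n); rewrite le_eqVlt; apply/orP; left; apply/eqP.
apply: eq_big_seq => xi; rewrite mem_index_ball => /andP[/set_mem Ixi _].
by rewrite lc.
Qed.

(** The way in which all later elements of L^2 are produced: two dominating vectors
    suffice since [1 + |lambda| ^ (2 * M)] has two terms. *)
Lemma dominated_Fourier c (a : R) (g h : V) :
  (forall xi, I xi -> abs2 (c xi) <= a * (abs2 (coef g xi) + abs2 (coef h xi))) ->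
  0 <= a ->
  exists2 f, (forall xi, I xi -> coef f xi = c xi) &
    sqnorm f <= a * (sqnorm g + sqnorm h).
Proof.
move=> cgh a0; apply: riesz_fischer => n.
apply: (@le_trans _ _ (\sum_(xi <- B n) a * (abs2 (coef g xi) + abs2 (coef h xi)))).
  rewrite big_seq [leRHS]big_seq; apply: ler_sum => xi.
  by rewrite mem_index_ball => /andP[/set_mem Ixi _]; exact: cgh.
rewrite -mulr_sumr ler_wpM2l// big_split /= lerD//; exact: bessel.
Qed.

(** Parseval's identity for inner products, in the form of a comparison: both sides
    are limits of the same finite sums. *)
Lemma eq_inner f g h k :
  (forall xi, I xi ->
    coef f xi * conjc (coef g xi) = coef h xi * conjc (coef k xi)) ->
  inner f g = inner h k.
Proof.
move=> E; apply/eqP; rewrite -subr_eq0; apply/eqP/abs2_eq0/eqP.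
rewrite eq_le abs2_ge0 andbT; apply/ler_addgt0Pr => r r0; rewrite add0r.
pose s := r / (2 * (sqnorm f + sqnorm h + 1)).
have D0 : 0 < sqnorm f + sqnorm h + 1 by rewrite ltr_wpDl// addr_ge0 ?sqnorm_ge0.
have s0 : 0 < s by rewrite divr_gt0// mulr_gt0.
have [N NP] := partial_sum_cvg g s0; have [M MP] := partial_sum_cvg k s0.
pose n := maxn N M.
have -> : inner f g - inner h k =
    inner h (S (coef k) n - k) + - inner f (S (coef g) n - g).
  rewrite !innerBr !inner_partial_sum.
  have -> : \sum_(xi <- B n) coef h xi * conjc (coef k xi) =
      \sum_(xi <- B n) coef f xi * conjc (coef g xi).
    apply: eq_big_seq => xi; rewrite mem_index_ball => /andP[/set_mem Ixi _].
    by rewrite E.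
  by rewrite opprB [RHS]addrC addrA subrK.
apply: le_trans (abs2_paral _ _) _; rewrite abs2N.
have hk := le_trans (cauchy_schwarz h (S (coef k) n - k))
  (ler_wpM2l (sqnorm_ge0 h) (MP n (leq_maxr _ _))).
have fg := le_trans (cauchy_schwarz f (S (coef g) n - g))
  (ler_wpM2l (sqnorm_ge0 f) (NP n (leq_maxl _ _))).
have : 2 * (sqnorm f + sqnorm h + 1) * s = r.
  by rewrite mulrC divfK// mulf_neq0// gt_eqF.
by move=> <-; nra.
Qed.

End theory.
End orthonormal_basis.

(** * Operators that are diagonal in an orthonormal basis *)

Section conjugation.
Context d (T : measurableType d) (R : realType)
  (mu : {measure set T -> \bar R}).
Local Notation V := (L2space mu).
Implicit Types f g : V.

Lemma L2repr_conj f : {ae mu, forall x, L2repr (L2conj f) x = conjc (L2repr f x)}.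
Proof. exact: L2repr_class. Qed.

Lemma L2reprD f g : {ae mu, forall x, L2repr (f + g) x = L2repr f x + L2repr g x}.
Proof.
have := L2repr_class (L2repr f + L2repr g).
by rewrite (_ : L2class _ = f + g) // L2classD !L2reprK.
Qed.

Lemma L2reprZ c f : {ae mu, forall x, L2repr (c *: f) x = c * L2repr f x}.
Proof. 
have := L2repr_class (c *: L2repr f).
by rewrite (_ : L2class _ = c *: f) // L2class_scale !L2reprK.
Qed.

Lemma L2space_ext f g : {ae mu, forall x, L2repr f x = L2repr g x} -> f = g.
Proof. by move=> /L2class_eq; rewrite !L2reprK. Qed.

Lemma L2conjK f : L2conj (L2conj f) = f.
Proof.
apply: L2space_ext.
by apply: filterS2 (L2repr_conj (L2conj f)) (L2repr_conj f) => x -> ->; rewrite conjcK.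
Qed.

Lemma L2conjD f g : L2conj (f + g) = L2conj f + L2conj g.
Proof.
apply: L2space_ext; apply: filterS3 (L2repr_conj (f + g)) (L2reprD f g)
  (filterI (L2reprD (L2conj f) (L2conj g)) (filterI (L2repr_conj f) (L2repr_conj g))).
by move=> x -> -> [-> [-> ->]]; rewrite conjcD.
Qed.

Lemma L2conjZ c f : L2conj (c *: f) = conjc c *: L2conj f.
Proof.
apply: L2space_ext; apply: filterS3 (L2repr_conj (c *: f)) (L2reprZ c f)
  (filterI (L2reprZ (conjc c) (L2conj f)) (L2repr_conj f)).
by move=> x -> -> [-> ->]; rewrite conjcM.
Qed.

Lemma L2conjB f g : L2conj (f - g) = L2conj f - L2conj g.
Proof. by rewrite L2conjD -(scaleN1r g) L2conjZ conjcN conjc1 scaleN1r. Qed.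

Lemma L2conj0 : L2conj 0 = 0 :> V.
Proof. by rewrite -[0 in LHS](subrr (0 : V)) L2conjB subrr. Qed.

End conjugation.

Section Hnorm_theory.
Context d (T : measurableType d) (R : realType)
  (mu : {measure set T -> \bar R}).
Local Notation V := (L2space mu).
Variable A : operator mu.

Lemma L2norm_le_Hnorm j k (f : V) : (j <= k)%N ->
  L2norm (iter j A f) <= Hnorm A k f.
Proof.
move=> jk; have jk1 : (j < k.+1)%N by [].
exact: (@le_bigmax _ _ _ 0 (fun j : 'I_k.+1 => L2norm (iter j A f)) (Ordinal jk1)).
Qed.

Lemma sqnorm_le_Hnorm j k (f : V) : (j <= k)%N ->
  sqnorm (iter j A f) <= Hnorm A k f ^+ 2.
Proof.
move=> jk; rewrite -sqr_L2norm lerXn2r ?nnegrE ?L2norm_ge0 ?L2norm_le_Hnorm//.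
exact: le_trans (L2norm_ge0 _) (L2norm_le_Hnorm f jk).
Qed.

Lemma Hnorm_ge0 k (f : V) : 0 <= Hnorm A k f.
Proof. exact: le_trans (L2norm_ge0 _) (L2norm_le_Hnorm f (leq0n k)). Qed.

Lemma Hnorm_lt k (f : V) (b : R) : 0 < b ->
  (forall j, (j <= k)%N -> sqnorm (iter j A f) < b ^+ 2) -> Hnorm A k f < b.
Proof.
move=> b0 fb; apply: bigmax_lt => // j _.
rewrite -(@ltr_pXn2r _ 2) ?nnegrE ?L2norm_ge0 ?(ltW b0)//.
by rewrite sqr_L2norm fb// -ltnS.
Qed.

End Hnorm_theory.

Section diagonal_operators.
Context d (T : measurableType d) (R : realType)
  (mu : {measure set T -> \bar R}) (K : nat).
Local Notation V := (L2space mu).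
Local Notation Z := 'rV[int]_K.
Variables (I : set Z) (e : Z -> V).
Hypothesis onb : orthonormal_basis I e.
Local Notation S := (partial_sum I e).
Local Notation coef := (Fourier e).

(** Diagonal operators with maximal domain: an element of L^2 with the coefficients
    of the would-be image is enough to be in the domain. *)
Record diagonalized (A : operator mu) (m : Z -> R[i]) : Prop := Diagonal {
  diagonal_Fourier : forall f, dom A f -> forall xi, I xi ->
    coef (A f) xi = m xi * coef f xi;
  diagonal_dom : forall f h, (forall xi, I xi -> coef h xi = m xi * coef f xi) ->
    dom A f }.

Section Hinf_diagonal.
Variables (A : operator mu) (m : Z -> R[i]).
Hypothesis dA : diagonalized A m.

Lemma Hinf_dom f j : Hinf A f -> dom A (iter j A f).
Proof. by move=> /(_ j.+1 isT); exact. Qed.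

Lemma Hinf_Fourier f j xi : Hinf A f -> I xi ->
  coef (iter j A f) xi = m xi ^+ j * coef f xi.
Proof.
move=> Af Ixi; elim: j => [|j IH]; first by rewrite mul1r.
by rewrite iterS (diagonal_Fourier dA)// ?IH ?mulrA -?exprS//; exact: Hinf_dom.
Qed.

(** Maximality of the domain makes membership of [Hinf] a condition on the Fourier
    coefficients alone. *)
Lemma HinfP f : Hinf A f <->
  forall j, exists h, forall xi, I xi -> coef h xi = m xi ^+ j * coef f xi.
Proof.
split=> [Af j|H k _ /= j _].
  by exists (iter j A f) => xi Ixi; exact: Hinf_Fourier.
suff [] : dom A (iter j A f) /\ forall xi, I xi ->
  coef (iter j A f) xi = m xi ^+ j * coef f xi by [].
elim: j => [|j [Dj Cj]].
  split=> [|xi _]; last by rewrite mul1r.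
  have [h hP] := H 1%N; apply: (diagonal_dom dA (h := h)) => xi Ixi.
  by rewrite hP.
have CSj xi : I xi -> coef (iter j.+1 A f) xi = m xi ^+ j.+1 * coef f xi.
  by move=> Ixi; rewrite iterS (diagonal_Fourier dA)// Cj// mulrA -exprS.
split=> //; have [h hP] := H j.+2; apply: (diagonal_dom dA (h := h)) => xi Ixi.
by rewrite hP// CSj// mulrA -exprS.
Qed.

Lemma Hinf_linear a f g : Hinf A f -> Hinf A g -> Hinf A (a *: f + g).
Proof.
move=> /HinfP Hf /HinfP Hg; apply/HinfP => j.
have [hf fP] := Hf j; have [hg gP] := Hg j.
exists (a *: hf + hg) => xi Ixi.
by rewrite !FourierD !FourierZ fP// gP//; ring.
Qed.

Lemma Hinf0 : Hinf A 0.
Proof. by apply/HinfP => j; exists 0 => xi _; rewrite Fourier0 mulr0. Qed.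

Lemma HinfZ a f : Hinf A f -> Hinf A (a *: f).
Proof. by move=> Af; rewrite -[a *: f]addr0; apply: Hinf_linear Hinf0. Qed.

Lemma HinfB f g : Hinf A f -> Hinf A g -> Hinf A (f - g).
Proof.
by move=> Af Ag; rewrite addrC -scaleN1r; exact: Hinf_linear.
Qed.

Lemma Hinf_eigen xi : I xi -> Hinf A (e xi).
Proof.
move=> Ixi; apply/HinfP => j; exists (m xi ^+ j *: e xi) => eta Ieta.
by rewrite FourierZ (Fourier_onb onb)//; case: eqP => [->|]; rewrite ?mulr0.
Qed.

Lemma Hinf_partial_sum c n : Hinf A (S c n).
Proof.
rewrite /partial_sum big_seq; elim/big_ind: _ => [|f g Af Ag|xi].
- exact: Hinf0.
- by rewrite -[f]scale1r; exact: Hinf_linear.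
- rewrite mem_index_ball => /andP[/set_mem Ixi _].
  exact/HinfZ/Hinf_eigen.
Qed.

(** The bound on [t] splits into the terms [1] and [abs2 (m xi) ^+ M], which cost [0]
    and [M] further applications of [A]. *)
Lemma Hinf_multiplier (t : Z -> R[i]) (a : R) M : 0 <= a ->
  (forall xi, I xi -> abs2 (t xi) <= a * (1 + abs2 (m xi) ^+ M)) ->
  forall g, Hinf A g -> exists h, [/\ Hinf A h,
    forall xi, I xi -> coef h xi = t xi * coef g xi &
    forall j, sqnorm (iter j A h) <=
      a * (sqnorm (iter j A g) + sqnorm (iter (j + M) A g))].
Proof.
move=> a0 tM g Ag.
have key j : exists2 h, forall xi, I xi -> coef h xi = m xi ^+ j * (t xi * coef g xi) &
    sqnorm h <= a * (sqnorm (iter j A g) + sqnorm (iter (j + M) A g)).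
  apply: (dominated_Fourier onb) => // xi Ixi.
  rewrite !Hinf_Fourier// !abs2M !abs2X.
  set x := abs2 (m xi); set y := abs2 (coef g xi).
  rewrite (_ : a * _ = x ^+ j * (a * (1 + x ^+ M)) * y); last first.
    by rewrite exprD; ring.
  by rewrite mulrA !ler_wpM2r ?abs2_ge0// ler_wpM2l ?exprn_ge0 ?abs2_ge0 ?tM.
have [h hP _] := key 0%N.
have Ah : Hinf A h.
  apply/HinfP => j; have [k kP _] := key j; exists k => xi Ixi.
  by rewrite kP// hP// mul1r.
exists h; split=> // [xi Ixi|j]; first by rewrite hP// mul1r.
have [k kP] := key j; congr (sqnorm _ <= _); apply: (Fourier_inj onb) => xi Ixi.
by rewrite kP// Hinf_Fourier// hP// mul1r.
Qed.

Lemma Hnorm_multiplier (t : Z -> R[i]) (a : R) M : 0 < a ->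
  (forall xi, I xi -> abs2 (t xi) <= a * (1 + abs2 (m xi) ^+ M)) ->
  forall k (r : R), 0 < r -> exists2 del : R, 0 < del & forall g h,
    Hinf A g -> (forall xi, I xi -> coef h xi = t xi * coef g xi) ->
    Hnorm A (k + M) g < del -> Hnorm A k h < r.
Proof.
move=> a0 tM k r r0; exists (r / (2 * a + 1)).
  by rewrite divr_gt0// addr_gt0// mulr_gt0.
move=> g h Ag hP gdel; have [h' [Ah' h'P hn]] := Hinf_multiplier (ltW a0) tM Ag.
have -> : h = h' by apply: (Fourier_inj onb) => xi Ixi; rewrite hP// h'P.
apply: Hnorm_lt => // j jk; apply: le_lt_trans (hn j) _.
have g1 := @sqnorm_le_Hnorm _ _ _ _ A j (k + M) g (leq_trans jk (leq_addr _ _)).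
have g2 := @sqnorm_le_Hnorm _ _ _ _ A (j + M) (k + M) g (leq_add jk (leqnn _)).
set x := Hnorm _ _ _ in gdel g1 g2.
have x0 : 0 <= x := Hnorm_ge0 _ _ _.
apply: (@le_lt_trans _ _ (2 * a * x ^+ 2)).
  by rewrite [2 * a]mulrC -mulrA ler_pM2l//; lra.
move: gdel; rewrite ltr_pdivlMr; last by rewrite addr_gt0// mulr_gt0.
move=> gdel.
apply: (@le_lt_trans _ _ ((x * (2 * a + 1)) ^+ 2)).
  have : 0 <= x ^+ 2 by exact: sqr_ge0.
  by nra.
by rewrite ltr_pXn2r ?nnegrE ?(ltW r0)// mulr_ge0// addr_ge0// mulr_ge0// ltW.
Qed.

Lemma Hnorm_partial_sum f k (r : R) : Hinf A f -> 0 < r ->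
  exists n, Hnorm A k (S (coef f) n - f) < r.
Proof.
move=> Af r0.
have r2 : 0 < r ^+ 2 / 2 by rewrite divr_gt0// exprn_gt0.
have /choice[N NP] j := partial_sum_cvg onb (iter j A f) r2.
pose n := (\max_(j < k.+1) N j)%N; exists n.
apply: Hnorm_lt => // j jk.
have Nn : (N j <= n)%N by have := leq_bigmax (Ordinal (jk : (j < k.+1)%N)); exact.
apply: le_lt_trans (_ : r ^+ 2 / 2 < _); last first.
  by rewrite ltr_pdivrMr// ltr_pMr ?exprn_gt0// ltr1n.
apply: le_trans (NP j n Nn); rewrite le_eqVlt; apply/orP; left; apply/eqP.
congr sqnorm; apply: (Fourier_inj onb) => xi Ixi.
rewrite Hinf_Fourier//; last by apply: HinfB => //; exact: Hinf_partial_sum.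
rewrite !FourierB !(Fourier_partial_sum onb)// Hinf_Fourier//.
by case: ifP => _; ring.
Qed.

(** A multiple of a basis vector fits into a given neighbourhood of 0 with a factor
    that is at worst polynomially small in [m xi].  Continuity at 0 tested on it
    gives polynomial bounds on symbols and on Fourier coefficients. *)
Lemma Hnorm_eigen k (del : R) xi : I xi -> 0 < del -> exists2 s : R, 0 < s &
  Hnorm A k (Complex s 0 *: e xi) < del /\
  s ^- 2 <= 8 / del ^+ 2 * (1 + abs2 (m xi) ^+ k).
Proof.
move=> Ixi del0; set x := abs2 (m xi); have x0 : 0 <= x := abs2_ge0 _.
have xk0 : 0 <= x ^+ k by rewrite exprn_ge0.
have c0 : 0 < 8 / del ^+ 2 * (1 + x ^+ k).
  by rewrite mulr_gt0 ?divr_gt0 ?exprn_gt0// ltr_pwDl.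
exists (Num.sqrt (8 / del ^+ 2 * (1 + x ^+ k))^-1).
  by rewrite sqrtr_gt0 invr_gt0.
have s2 : Num.sqrt (8 / del ^+ 2 * (1 + x ^+ k))^-1 ^+ 2 =
    (8 / del ^+ 2 * (1 + x ^+ k))^-1 by rewrite sqr_sqrtr// invr_ge0 ltW.
split; last by rewrite s2 invrK.
apply: Hnorm_lt => // j jk.
have He := HinfZ (Complex (Num.sqrt (8 / del ^+ 2 * (1 + x ^+ k))^-1) 0)
  (Hinf_eigen Ixi).
have -> : iter j A (Complex (Num.sqrt (8 / del ^+ 2 * (1 + x ^+ k))^-1) 0 *: e xi) =
    (m xi ^+ j * Complex (Num.sqrt (8 / del ^+ 2 * (1 + x ^+ k))^-1) 0) *: e xi.
  apply: (Fourier_inj onb) => eta Ieta; rewrite Hinf_Fourier// !FourierZ (Fourier_onb onb)//.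
  by case: eqP => [->|]; rewrite ?mulr1 ?mulr0.
rewrite sqnormZ [sqnorm (e xi)]/sqnorm (onb_inner onb)// eqxx mulr1.
rewrite abs2M abs2X -/x [abs2 (Complex _ _)]/abs2 /= expr0n addr0 s2.
rewrite ltr_pdivrMr//.
have d2 : 0 < del ^+ 2 by rewrite exprn_gt0.
have -> : del ^+ 2 * (8 / del ^+ 2 * (1 + x ^+ k)) = 8 * (1 + x ^+ k).
  by field; rewrite gt_eqF.
have : x ^+ j <= 1 + x ^+ k.
  have [x1|/ltW x1] := lerP x 1.
    by apply: le_trans (exprn_ile1 _ _ _) _ => //; rewrite lerDl.
  by apply: le_trans (_ : x ^+ k <= _); [exact: ler_weXn2l|rewrite lerDr].
by lra.
Qed.

End Hinf_diagonal.
End diagonal_operators.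

(** * Adjoints, multipliers and eigensystems *)

Section adjoints.
Context d (T : measurableType d) (R : realType)
  (mu : {measure set T -> \bar R}) (K : nat).
Local Notation V := (L2space mu).
Local Notation Z := 'rV[int]_K.
Variables (I : set Z) (e : Z -> V).
Hypothesis onb : orthonormal_basis I e.
Local Notation coef := (Fourier e).

Lemma adjoint_spec (A : operator mu) g : dom (adjoint A) g ->
  adjoint_rel A g (adjoint A g).
Proof. exact: xgetPex. Qed.

Lemma diagonal_eigen (A : operator mu) m xi : diagonalized I e A m -> I xi ->
  dom A (e xi) /\ A (e xi) = m xi *: e xi.
Proof.
move=> dA Ixi; have De : dom A (e xi).
  apply: (diagonal_dom dA (h := m xi *: e xi)) => eta Ieta.
  by rewrite FourierZ (Fourier_onb onb)//; case: eqP => [->|]; rewrite ?mulr0.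
split=> //; apply: (Fourier_inj onb) => eta Ieta.
rewrite (diagonal_Fourier dA)// FourierZ (Fourier_onb onb)//.
by case: eqP => [->|]; rewrite ?mulr0.
Qed.

Lemma diagonal_adjoint (A : operator mu) m : diagonalized I e A m ->
  diagonalized I e (adjoint A) (fun xi => conjc (m xi)).
Proof.
move=> dA; split=> [g Dg xi Ixi|g h gh].
  have [De Ae] := diagonal_eigen dA Ixi.
  have := adjoint_spec Dg De; rewrite Ae innerZl => E.
  by rewrite /Fourier innerC -E conjcM -innerC.
exists h => f Df; apply: (eq_inner onb) => xi Ixi.
by rewrite (diagonal_Fourier dA)// gh// conjcM conjcK mulrCA mulrA.
Qed.

(** The adjoint on test functions multiplies by the conjugate symbol.  Uniqueness of
    the adjoint vector comes from testing with the basis vectors. *)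
Lemma adjoint_multiplier (A : operator mu) m (P : V -> V) s g h :
  diagonalized I e A m ->
  (forall f, Hinf A f -> forall xi, I xi -> coef (P f) xi = s xi * coef f xi) ->
  (forall xi, I xi -> coef h xi = conjc (s xi) * coef g xi) ->
  adjoint (Operator (Hinf A) P) g = h.
Proof.
move=> dA Ps gh; apply: xget_unique => [f Af|k /= kP].
  apply: (eq_inner onb) => xi Ixi.
  by rewrite (Ps f Af)// gh// conjcM conjcK mulrCA mulrA.
apply: (Fourier_inj onb) => xi Ixi.
have Ae := Hinf_eigen onb dA Ixi.
rewrite /Fourier [LHS]innerC -(kP _ Ae) [RHS]innerC; congr conjc.
apply: (eq_inner onb) => eta Ieta.
by rewrite (Ps _ Ae)// gh// conjcM conjcK mulrCA mulrA.
Qed.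

End adjoints.

Section eigensystems.
Context d (T : measurableType d) (R : realType)
  (mu : {measure set T -> \bar R}) (K : nat).
Local Notation V := (L2space mu).
Local Notation Z := 'rV[int]_K.
Variables (L : operator mu) (I : set Z) (lambda : Z -> R[i]) (u v : Z -> V).
Hypothesis sys : eigensystem L I lambda u v.

(** The square norm of [u xi - v xi] is [1 - 1 - 1 + 1]. *)
Lemma eigensystem_eq xi : I xi -> u xi = v xi.
Proof.
move=> Ixi; have [nu nv] := es_normed sys Ixi.
have uv := es_biorthogonal sys Ixi Ixi; rewrite eqxx in uv.
apply/eqP; rewrite -subr_eq0; apply/eqP/sqnorm_eq0.
rewrite /sqnorm !(innerBl, innerBr) (innerC (u xi) (v xi)) uv !inner_self.
by rewrite -!sqr_L2norm nu nv /= expr1n; lra.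
Qed.

Lemma eigensystem_onb : orthonormal_basis I v.
Proof.
split=> [xi eta Ixi Ieta|f].
  by rewrite -(eigensystem_eq Ixi); exact: (es_biorthogonal sys).
have E c : expansion I u c f <-> expansion I v c f.
  rewrite !expansionE; suff -> : partial_sum I u c = partial_sum I v c by [].
  apply/funext => n; apply: eq_big_seq => xi.
  by rewrite mem_index_ball => /andP[/set_mem Ixi _]; rewrite eigensystem_eq.
have [c cf cu] := es_basis sys f.
exists c; first by rewrite -E.
by move=> c'; rewrite -E; exact: cu.
Qed.

Lemma low_eigenvalues (b : R) : exists n : nat, forall xi, I xi ->
  Normc.normc (lambda xi) < b -> xi \in index_ball R I n.
Proof.
have [r rP] := es_infty sys b.
exists (Num.truncn r).+1 => xi Ixi xib; rewrite mem_index_ball mem_set//=.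
rewrite leNgt; apply/negP => h.
have := rP xi Ixi (ltW (lt_trans (truncnS_gt r) h)).
by rewrite leNgt xib.
Qed.

(** The points [1 / (k + 1)] are infinitely many and of modulus at most 1, whereas
    only finitely many eigenvalues have modulus less than 2. *)
Lemma resolvent_point : exists z, resolvent_set L z.
Proof.
pose z (k : nat) : R[i] := Complex k.+1%:R^-1 0.
suff [k kI] : exists k, ~ (lambda @` I) (z k).
  exists (z k); move: kI; rewrite -(es_spectrum sys) /spectrum => H.
  by apply: contrapT => ?; apply: H.
apply: contrapT => /forallNP H.
have {}H k : (lambda @` I) (z k) by apply: contrapT; exact: H.
have zinj : injective z.
  by move=> i j [] /invr_inj /eqP; rewrite eqr_nat => /eqP[].
have [n nP] := low_eigenvalues 2.
pose s := [seq lambda xi | xi <- index_ball R I n].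
have zs k : z k \in s.
  have [xi Ixi lz] := H k; rewrite -lz; apply: map_f; apply: nP => //.
  rewrite lz /= expr0n addr0 sqrtr_sqr ger0_norm ?invr_ge0//.
  rewrite (@le_lt_trans _ _ 1)// ?ltr1n// invf_le1// ?ler1n//.
have : (size [seq z k | k <- iota 0 (size s).+1] <= size s)%N.
  apply: uniq_leq_size; first by rewrite map_inj_uniq// iota_uniq.
  by move=> _ /mapP[k _ ->].
by rewrite size_map size_iota ltnn.
Qed.

(** Maximality of the domain: if [h] has the coefficients [lambda xi * f^ xi] and [z]
    is in the resolvent set, the solution [k] of [L k - z *: k = h - z *: f] has the
    same coefficients as [f], hence is [f]. *)
Lemma eigensystem_diagonal : diagonalized I v L lambda.
Proof.
have onb := eigensystem_onb.
have DF f : dom L f -> forall xi, I xi ->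
    Fourier v (L f) xi = lambda xi * Fourier v f xi.
  move=> Df xi Ixi; have [Dv Lv] := es_adjoint_eigen sys Ixi.
  by rewrite /Fourier (adjoint_spec Dv Df) Lv innerZr conjcK.
split=> // f h fh; have [z zL] := resolvent_point.
have [res _] := zL; have [k [[Dk Lk] _]] := res (h - z *: f).
suff -> : f = k by [].
apply: (Fourier_inj onb) => xi Ixi.
have := congr1 (fun g => Fourier v g xi) Lk.
rewrite /= !FourierB !FourierZ fh// DF// -!mulrBl => /mulfI E.
apply/esym/E; rewrite subr_eq0; apply/eqP => lz.
have : spectrum L z by rewrite (es_spectrum sys); exists xi.
exact.
Qed.

End eigensystems.

(** * Growth and summability estimates *)

(** Bernoulli's inequality. *)
Lemma exprn_unbounded (R : realType) (x c : R) : 1 < x ->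
  exists k0, forall k, (k0 <= k)%N -> c < x ^+ k.
Proof.
move=> x1; have x0 : 0 < x - 1 by rewrite subr_gt0.
have bern k : 1 + (x - 1) * k%:R <= x ^+ k.
  elim: k => [|k IH]; first by rewrite mulr0 addr0 expr0.
  rewrite exprS -natr1.
  have := ler_wpM2l (ltW (lt_trans ltr01 x1)) IH.
  have : 0 <= (x - 1) ^+ 2 * k%:R by rewrite mulr_ge0 ?sqr_ge0.
  by nra.
exists (Num.truncn (c / (x - 1))).+1 => k ck.
apply: lt_le_trans (bern k); rewrite ltr_pwDl// mulrC -ler_pdivrMr//.
by apply: le_trans (ltW (truncnS_gt _)) _; rewrite ler_nat.
Qed.

Lemma powD1_le (R : realType) (x : R) k : 0 <= x -> (1 + x) ^+ k <= 2 ^+ k * (1 + x ^+ k).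
Proof.
move=> x0; have [x1|/ltW x1] := lerP x 1.
  apply: (@le_trans _ _ (2 ^+ k)).
    by apply: lerXn2r; rewrite ?nnegrE; lra.
  by rewrite ler_peMr ?exprn_ge0// lerDl exprn_ge0.
apply: (@le_trans _ _ ((2 * x) ^+ k)).
  by apply: lerXn2r; rewrite ?nnegrE; lra.
by rewrite exprMn ler_wpM2l ?exprn_ge0// lerDr.
Qed.

Section weight.
Context (R : realType) (K : nat) (m : nat) (lambda : 'rV[int]_K -> R[i]).
Hypothesis m_gt0 : (0 < m)%N.
Local Notation W := (weight m lambda).

Lemma weight_ge0 xi : 0 <= W xi. Proof. exact: powR_ge0. Qed.

(** The only property of the weight that involves the exponent [1 / (2 m)]. *)
Lemma weightX xi : W xi ^+ (2 * m) = 1 + abs2 (lambda xi).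
Proof.
rewrite -powR_mulrn ?weight_ge0// -powRrM natrM mulVf ?powRr1 ?normc_sqr//.
  by rewrite addr_ge0 ?abs2_ge0.
by rewrite mulf_neq0 ?pnatr_eq0 -?lt0n.
Qed.

Lemma weight_ge1 xi : 1 <= W xi.
Proof.
rewrite -(@ler_pXn2r _ (2 * m)) ?nnegrE ?weight_ge0 ?muln_gt0//.
by rewrite weightX expr1n lerDl abs2_ge0.
Qed.

Lemma weight_gt1 xi : lambda xi != 0 -> 1 < W xi.
Proof.
move=> l0; rewrite -(@ltr_pXn2r _ (2 * m)) ?nnegrE ?weight_ge0 ?muln_gt0//.
rewrite weightX expr1n ltrDl lt_def abs2_ge0 andbT.
by apply: contra l0 => /eqP /abs2_eq0 ->.
Qed.

Lemma weight_ge (b : R) xi : 0 <= b -> b ^+ m <= Normc.normc (lambda xi) ->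
  b <= W xi.
Proof.
move=> b0 bl; rewrite -(@ler_pXn2r _ (2 * m)) ?nnegrE ?weight_ge0 ?muln_gt0//.
rewrite weightX -normc_sqr mulnC exprM; apply: ler_wpDl => //.
by rewrite lerXn2r ?nnegrE ?exprn_ge0// (le_trans _ bl)// exprn_ge0.
Qed.

Lemma weight_powN k xi : W xi `^ (- k%:R) = W xi ^- k.
Proof. by rewrite powRN powR_mulrn// weight_ge0. Qed.

End weight.

Section square_summable.
Context (R : realType) (Z : eqType).

Lemma geom4_le M : \sum_(k < M) (4 ^- k : R) <= 2.
Proof.
suff : \sum_(k < M) (4 ^- k : R) <= 2 - 2 * 4 ^- M.
  by move/le_trans; apply; rewrite lerBlDr lerDl mulr_ge0 ?invr_ge0 ?exprn_ge0.
elim: M => [|M IH]; first by rewrite big_ord0 expr0 invr1; lra.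
rewrite big_ord_recr /= exprS invfM.
have : 0 <= 4 ^- M :> R by rewrite invr_ge0 exprn_ge0.
by lra.
Qed.

(** A point may occur several times in the sequence; giving it the value [2 ^ -k] for
    its first occurrence [k] keeps the sum of squares below the geometric
    series. *)
Lemma square_summable_along (x : nat -> Z) : exists c : Z -> R,
  [/\ forall k, 2 ^- k <= c (x k),
      forall xi, (forall k, x k != xi) -> c xi = 0 &
      forall s : seq Z, uniq s -> \sum_(xi <- s) c xi ^+ 2 <= 2].
Proof.
have /choice[j jP] xi : exists j, (exists k, x k == xi) ->
    x j == xi /\ forall k, x k == xi -> (j <= k)%N.
  have [[k0 k0P]|n] := pselect (exists k, x k == xi); last by exists 0%N => /n.
  have ex : exists k, x k == xi by exists k0.
  by exists (ex_minn ex) => _; case: ex_minnP.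
exists (fun xi => if `[< exists k, x k == xi >] then 2 ^- j xi else 0); split.
- move=> k; have ex : exists k', x k' == x k by exists k.
  rewrite asboolT// ler_pV2 ?inE ?unitfE ?exprn_gt0 ?gt_eqF ?exprn_gt0//.
  by rewrite ler_weXn2l ?ler1n// (jP _ ex).2.
- by move=> xi nx; case: asboolP => // -[k]; rewrite (negPf (nx k)).
move=> s us; pose M := (\max_(xi <- s) (j xi).+1)%N.
apply: (@le_trans _ _ (\sum_(xi <- s) \sum_(k < M) (x k == xi)%:R * 4 ^- k)).
  rewrite big_seq [leRHS]big_seq; apply: ler_sum => xi xs.
  case: asboolP => [ex|_]; last first.
    by rewrite expr0n sumr_ge0// => k _; rewrite mulr_ge0// invr_ge0 exprn_ge0.
  have [/eqP xj _] := jP xi ex.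
  have jM : (j xi < M)%N by exact: (@leq_bigmax_seq _ s xpredT (fun xi => (j xi).+1)).
  rewrite (bigD1 (Ordinal jM))//= xj eqxx mul1r.
  have -> : (2 ^- j xi) ^+ 2 = 4 ^- j xi :> R.
    by rewrite exprVn -exprM mulnC exprM -natrX.
  rewrite lerDl; apply: sumr_ge0 => k _.
  by rewrite mulr_ge0// invr_ge0 exprn_ge0.
rewrite exchange_big /=.
apply: (@le_trans _ _ (\sum_(k < M) 4 ^- k)).
  apply: ler_sum => k _; rewrite -mulr_suml ler_piMl ?invr_ge0 ?exprn_ge0//.
  have [xs|xs] := boolP (x k \in s).
    rewrite (bigD1_seq (x k))//= eqxx big1 ?addr0// => xi.
    by rewrite eq_sym => /negPf ->.
  rewrite big1_seq// => xi /andP[_ xis]; case: eqP => // xk.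
  by rewrite xk xis in xs.
exact: geom4_le.
Qed.

End square_summable.

(** * Distributions and division by the symbol *)

Section distributions.
Context d (T : measurableType d) (R : realType)
  (mu : {measure set T -> \bar R}) (K : nat).
Local Notation V := (L2space mu).
Local Notation Z := 'rV[int]_K.
Variables (I : set Z) (v : Z -> V) (L : operator mu) (lambda : Z -> R[i]).
Hypothesis onb : orthonormal_basis I v.
Hypothesis dL : diagonalized I v L lambda.
Local Notation coef := (Fourier v).
Local Notation Ls := (adjoint L).

Let dLs := diagonal_adjoint onb dL.

Lemma dist_test_conj g : Hinf Ls g -> dist_test L (L2conj g).
Proof. by rewrite /dist_test /= L2conjK. Qed.

Lemma dist0 w : Defs.distribution L w -> w 0 = 0.
Proof.
move=> dw; have t0 : dist_test L 0.
  by rewrite /dist_test /= L2conj0; exact: Hinf0 dLs.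
have := dist_linear dw 1 t0 t0.
by rewrite scale1r addr0 mul1r -[X in X = _]addr0 => /addrI.
Qed.

Lemma dist_conjZ w a g : Defs.distribution L w -> Hinf Ls g ->
  w (L2conj (a *: g)) = conjc a * w (L2conj g).
Proof.
move=> dw Hg; have t0 : dist_test L 0.
  by rewrite /dist_test /= L2conj0; exact: Hinf0 dLs.
have := dist_linear dw (conjc a) (dist_test_conj Hg) t0.
by rewrite addr0 dist0// addr0 L2conjZ.
Qed.

Lemma dist_conjD w g h : Defs.distribution L w -> Hinf Ls g -> Hinf Ls h ->
  w (L2conj (g + h)) = w (L2conj g) + w (L2conj h).
Proof.
move=> dw Hg Hh.
have := dist_linear dw 1 (dist_test_conj Hg) (dist_test_conj Hh).
by rewrite scale1r mul1r L2conjD.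
Qed.

(** The partial sums of [r] converge to [r] in every seminorm, and the distribution
    kills each of their terms. *)
Lemma dist_vanish w r : Defs.distribution L w -> Hinf Ls r ->
  (forall xi, I xi -> dist_Fourier v w xi = 0 \/ coef r xi = 0) ->
  w (L2conj r) = 0.
Proof.
move=> dw Hr wr; apply: normc_small_eq0 => eps eps0.
have [N [del del0 H]] := dist_continuous dw (dist_test_conj Hr) eps0.
have [n rn] := Hnorm_partial_sum onb dLs N Hr del0.
have HS := Hinf_partial_sum onb dLs (coef r) n.
have := H _ (dist_test_conj HS); rewrite -L2conjB L2conjK => /(_ rn).
suff -> : w (L2conj (partial_sum I v (coef r) n)) = 0.
  by rewrite sub0r !normc_sqr_lt// abs2N.
rewrite /partial_sum.
have : {in index_ball R I n, forall xi, w (L2conj (coef r xi *: v xi)) = 0 /\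
    Hinf Ls (coef r xi *: v xi)}.
  move=> xi; rewrite mem_index_ball => /andP[/set_mem Ixi _].
  have Hv := Hinf_eigen onb dLs Ixi.
  split; last exact: HinfZ dLs _ _ Hv.
  rewrite dist_conjZ//.
  by have [wv|->] := wr xi Ixi; rewrite ?[w _]wv ?mulr0// conjc0 mul0r.
elim: (index_ball R I n) => [_|xi s IH xs].
  by rewrite big_nil L2conj0 dist0.
suff [] : w (L2conj (\sum_(j <- xi :: s) coef r j *: v j)) = 0 /\
  Hinf Ls (\sum_(j <- xi :: s) coef r j *: v j) by [].
elim: (xi :: s) xs => [_|x t IHt xt].
  by rewrite big_nil L2conj0 dist0//; split => //; exact: Hinf0 dLs.
have [] := IHt _; first by move=> y yt; apply: xt; rewrite inE yt orbT.
have [wx Hx] := xt x (mem_head _ _).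
rewrite big_cons => wt Ht; split; first by rewrite dist_conjD// wx wt addr0.
by rewrite -[_ *: _]scale1r; apply: Hinf_linear dLs _ _ _ Hx Ht.
Qed.

(** Continuity at 0, tested on multiples of the conjugate basis vectors. *)
Lemma dist_Fourier_bound w : Defs.distribution L w -> exists2 a : R, 0 < a &
  exists N, forall xi, I xi ->
    abs2 (dist_Fourier v w xi) <= a * (1 + abs2 (lambda xi) ^+ N).
Proof.
move=> dw.
have t0 : dist_test L 0 by rewrite /dist_test /= L2conj0; exact: Hinf0 dLs.
have [N [del del0 H]] := dist_continuous dw t0 ltr01.
exists (8 / del ^+ 2); first by rewrite divr_gt0// exprn_gt0.
exists N => xi Ixi; have Hv := Hinf_eigen onb dLs Ixi.
have [s s0 [sdel]] := Hnorm_eigen onb dLs N Ixi del0.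
rewrite abs2J; apply: le_trans.
have := H _ (dist_test_conj (HinfZ dLs (Complex s 0) Hv)).
rewrite subr0 L2conjK => /(_ sdel).
rewrite dist0// subr0 dist_conjZ// normc_sqr_lt// abs2M abs2J expr1n.
rewrite [abs2 (Complex s 0)]/abs2 /= expr0n addr0 => h.
by rewrite -[_ ^- 2]mul1r ler_pdivlMr ?exprn_gt0// mulrC; exact: ltW.
Qed.

Variables (P : V -> V) (sigma : Z -> R[i]).
Hypothesis hP : fourier_multiplier L I v P sigma.

(** Continuity of [P] at 0, tested on multiples of the basis vectors; the symbol is a
    coefficient of the image, hence bounded by its norm. *)
Lemma symbol_bound : exists2 a : R, 0 < a &
  exists N, forall xi, I xi ->
    abs2 (sigma xi) <= a * (1 + abs2 (lambda xi) ^+ N).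
Proof.
have P0 : P 0 = 0.
  have := fm_linear hP 1 (Hinf0 dL) (Hinf0 dL).
  by rewrite scaler0 addr0 scale1r -[X in X = _]addr0 => /addrI.
have [N [del del0 H]] := fm_continuous hP (Hinf0 dL) 0 ltr01.
exists (8 / del ^+ 2); first by rewrite divr_gt0// exprn_gt0.
exists N => xi Ixi; have Hv := Hinf_eigen onb dL Ixi.
have [s s0 [sdel]] := Hnorm_eigen onb dL N Ixi del0.
apply: le_trans; have Hsv := HinfZ dL (Complex s 0) Hv.
have := H _ Hsv; rewrite subr0 P0 subr0 => /(_ sdel) Psv.
have := abs2_Fourier_le onb (P (Complex s 0 *: v xi)) Ixi.
rewrite (fm_symbol hP Hsv Ixi) FourierZ (Fourier_onb onb)// eqxx mulr1.
rewrite abs2M [abs2 (Complex s 0)]/abs2 /= expr0n addr0 => h.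
rewrite -[_ ^- 2]mul1r ler_pdivlMr ?exprn_gt0//.
apply: le_trans h _; apply: le_trans (@sqnorm_le_Hnorm _ _ _ _ L 0 0 _ isT) _.
by rewrite expr_le1//; [exact: ltW|exact: Hnorm_ge0].
Qed.

(** Sufficiency.  Let [Q] multiply by the inverse of the conjugate symbol.  Then
    [w phi = f (conj (Q (conj phi)))] is a distribution, and [P w] evaluates [f] on
    [Q (P^* g)], where [g = conj phi].  This differs from [g] by a vector with
    coefficients supported where the symbol vanishes. *)
Lemma solvable_of_inverse_bound (a : R) N : 0 < a ->
  (forall xi, I xi -> abs2 (sigma xi)^-1 <= a * (1 + abs2 (lambda xi) ^+ N)) ->
  globally_solvable L I v P sigma.
Proof.
move=> a0 aN f [df f0].
pose t xi := (conjc (sigma xi))^-1.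
have tN xi : I xi -> abs2 (t xi) <= a * (1 + abs2 (conjc (lambda xi)) ^+ N).
  by move=> Ixi; rewrite /t -conjc_inv !abs2J aN.
pose Q g := xget 0 [set h | forall xi, I xi -> coef h xi = t xi * coef g xi].
have QP g : Hinf Ls g -> Hinf Ls (Q g) /\
    forall xi, I xi -> coef (Q g) xi = t xi * coef g xi.
  move=> Hg; have [h [Hh hP' _]] := Hinf_multiplier onb dLs (ltW a0) tN Hg.
  suff -> : Q g = h by [].
  apply: xget_unique => // k kP; apply: (Fourier_inj onb) => xi Ixi.
  by rewrite kP// hP'.
pose w phi := f (L2conj (Q (L2conj phi))).
have Qlin b g h : Hinf Ls g -> Hinf Ls h -> Q (b *: g + h) = b *: Q g + Q h.
  move=> Hg Hh; apply: (Fourier_inj onb) => xi Ixi.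
  rewrite (QP _ (Hinf_linear dLs b Hg Hh)).2// !FourierD !FourierZ.
  by rewrite (QP _ Hg).2// (QP _ Hh).2//; ring.
exists w.
  split=> [b phi psi tphi tpsi|phi tphi e e0].
    rewrite /w L2conjD L2conjZ Qlin// L2conjD L2conjZ conjcK.
    by rewrite (dist_linear df)//; apply: dist_test_conj; have [] := QP _ tphi;
      have [] := QP _ tpsi.
  have [Qphi _] := QP _ tphi.
  have [k [r r0 H]] := dist_continuous df (dist_test_conj Qphi) e0.
  have [del del0 Hdel] := Hnorm_multiplier onb dLs a0 tN k r0.
  exists (k + N)%N, del => // psi tpsi psidel; have [Qpsi _] := QP _ tpsi.
  apply: H; first exact: dist_test_conj.
  rewrite -L2conjB L2conjK; apply: Hdel psidel; rewrite L2conjB.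
    exact: HinfB dLs _ _ tpsi tphi.
  move=> xi Ixi; rewrite !FourierB (QP _ tphi).2// (QP _ tpsi).2//; ring.
move=> phi /set_mem tphi; rewrite /dist_extension.
have [b b0 [M sM]] := symbol_bound.
have sM' xi : I xi -> abs2 (conjc (sigma xi)) <=
    b * (1 + abs2 (conjc (lambda xi)) ^+ M) by move=> Ixi; rewrite !abs2J sM.
set g := L2conj phi; have Hg : Hinf Ls g by [].
have [h [Hh hE _]] := Hinf_multiplier onb dLs (ltW b0) sM' Hg.
rewrite (adjoint_multiplier onb dL (fm_symbol hP) hE) /w L2conjK.
have [HQ QE] := QP _ Hh.
rewrite -[in RHS](L2conjK phi) -/g -[in RHS](subrK (Q h) g).
rewrite dist_conjD//; last exact: HinfB dLs _ _ Hg HQ.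
rewrite (dist_vanish df (HinfB dLs Hg HQ)) ?add0r// => xi Ixi.
have [s0|s0] := eqVneq (sigma xi) 0; first by left; exact: f0.
right; rewrite FourierB QE// hE// mulKf ?subrr//.
by rewrite conjc_eq0.
Qed.

(** The estimate behind necessity.  The vector with coefficients [c], paired with
    conjugates of test functions, is an admissible distribution; a solution [w] has
    coefficients [c / sigma], which grow polynomially. *)
Lemma solvable_Fourier_quotient c : (forall xi, I xi -> sigma xi = 0 -> c xi = 0) ->
  (exists b : R, forall n, \sum_(xi <- index_ball R I n) abs2 (c xi) <= b) ->
  globally_solvable L I v P sigma ->
  exists2 a : R, 0 < a & exists N, forall xi, I xi ->
    abs2 (c xi) <= abs2 (sigma xi) * (a * (1 + abs2 (lambda xi) ^+ N)).
Proof.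
move=> c0 [b cb] solv.
have [h hE _] := riesz_fischer onb cb.
pose f phi := inner h (L2conj phi).
have fF xi : I xi -> dist_Fourier v f xi = c xi.
  by move=> Ixi; rewrite /dist_Fourier /f L2conjK -hE.
have admf : admissible L I v sigma f.
  split; last by move=> xi Ixi s0; rewrite fF// c0.
  split=> [x phi psi _ _|phi _ e e0].
    by rewrite /f L2conjD L2conjZ innerDr innerZr conjcK.
  exists 0%N; exists (e / (sqnorm h + 1)).
    by rewrite divr_gt0// ltr_wpDl ?sqnorm_ge0.
  move=> psi _ hpsi; rewrite /f -innerBr -L2conjB normc_sqr_lt//.
  apply: le_lt_trans (cauchy_schwarz _ _) _.
  have := @sqnorm_le_Hnorm _ _ _ _ Ls 0 0 (L2conj (psi - phi)) isT.
  move: hpsi (Hnorm_ge0 Ls 0 (L2conj (psi - phi))).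
  set y := Hnorm _ _ _; rewrite ltr_pdivlMr ?ltr_wpDl ?sqnorm_ge0//.
  move=> hy y0 ny; set x := sqnorm h in hy *; have x0 : 0 <= x := sqnorm_ge0 _.
  apply: (@le_lt_trans _ _ ((y * (x + 1)) ^+ 2)).
    apply: le_trans (ler_wpM2l x0 ny) _; have : 0 <= y ^+ 2 by exact: sqr_ge0.
    by nra.
  by rewrite ltr_pXn2r ?nnegrE ?(ltW e0)// mulr_ge0// addr_ge0.
have [w dw weq] := solv f admf.
have [a a0 [N aN]] := dist_Fourier_bound dw.
exists a => //; exists N => xi Ixi.
have Hv := Hinf_eigen onb dLs Ixi.
rewrite -fF// /dist_Fourier.
have -> : f (L2conj (v xi)) = sigma xi * w (L2conj (v xi)).
  rewrite -(weq _ (mem_set (dist_test_conj Hv))) /dist_extension L2conjK.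
  rewrite (adjoint_multiplier onb dL (fm_symbol hP) (h := conjc (sigma xi) *: v xi)).
    by rewrite dist_conjZ// conjcK.
  move=> eta Ieta; rewrite FourierZ (Fourier_onb onb)//.
  by case: eqP => [->|]; rewrite ?mulr0.
by rewrite abs2M ler_wpM2l ?abs2_ge0 ?aN.
Qed.

End distributions.

(** * Lower bounds for the symbol *)

Section lower_bounds.
Context d (T : measurableType d) (R : realType)
  (mu : {measure set T -> \bar R}) (K : nat).
Local Notation V := (L2space mu).
Local Notation Z := 'rV[int]_K.
Variables (L : operator mu) (I : set Z) (lambda : Z -> R[i]) (u v : Z -> V).
Hypothesis sys : eigensystem L I lambda u v.
Variables (m : nat) (sigma : Z -> R[i]).
Hypothesis m_gt0 : (0 < m)%N.
Local Notation W := (weight m lambda).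

Definition symbol_lower_bound : Prop := exists2 M : R, 0 < M &
  forall xi, I xi -> sigma xi != 0 -> lambda xi != 0 ->
    W xi `^ (- M) < Normc.normc (sigma xi).

(** At the finitely many indices with [lambda xi = 0] the inverse of the symbol is
    bounded by the constant [C]; elsewhere the real exponent [M] may be rounded up
    to an integer since the weight is at least 1. *)
Lemma inverse_bound_of_lower_bound : symbol_lower_bound ->
  exists2 a : R, 0 < a & exists N, forall xi, I xi ->
    abs2 (sigma xi)^-1 <= a * (1 + abs2 (lambda xi) ^+ N).
Proof.
move=> [M M0 HM].
have [n low] := low_eigenvalues sys 1.
pose C := \sum_(xi <- index_ball R I n) abs2 (sigma xi)^-1.
have C0 : 0 <= C by rewrite sumr_ge0// => xi _; exact: abs2_ge0.
pose k := (Num.truncn M).+1.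
exists (2 ^+ k + C); first by rewrite ltr_pwDl// exprn_gt0.
exists k => xi Ixi; set x := abs2 (lambda xi).
have x0 : 0 <= x := abs2_ge0 _.
have xk : 0 <= x ^+ k by rewrite exprn_ge0.
have [s0|s0] := eqVneq (sigma xi) 0.
  by rewrite s0 invr0 abs20 mulr_ge0 ?addr_ge0 ?exprn_ge0.
have [l0|l0] := eqVneq (lambda xi) 0.
  apply: (@le_trans _ _ C); last first.
    by rewrite -[leLHS]mulr1 ler_pM// ?lerDr ?lerDl ?exprn_ge0.
  rewrite /C (bigD1_seq xi) ?index_ball_uniq//= ?lerDl ?sumr_ge0//.
    by move=> eta _; exact: abs2_ge0.
  by apply: low => //; rewrite l0 Normc.normc0.
have W1 := weight_ge1 lambda m_gt0 xi.
have Wk : (W xi ^+ k)^-1 <= Normc.normc (sigma xi).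
  apply: le_trans (ltW (HM xi Ixi s0 l0)).
  rewrite -weight_powN// ler_powR// lerN2.
  exact/ltW/truncnS_gt.
apply: (@le_trans _ _ ((1 + x) ^+ k)); last first.
  apply: le_trans (powD1_le k x0) _.
  by rewrite ler_wpM2r ?addr_ge0// lerDl.
rewrite abs2V// -normc_sqr.
have Wk0 : 0 < W xi ^+ k by rewrite exprn_gt0// (lt_le_trans ltr01).
have : Normc.normc (sigma xi) ^- 2 <= (W xi ^+ k) ^+ 2.
  have n0 : 0 < Normc.normc (sigma xi).
    by apply: lt_le_trans Wk; rewrite invr_gt0.
  rewrite -exprVn lerXn2r ?nnegrE ?invr_ge0 ?(ltW n0) ?(ltW Wk0)//.
  by rewrite -[leRHS]invrK lef_pV2// posrE ?invr_gt0.
move/le_trans; apply; rewrite -(weightX lambda m_gt0) -!exprM.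
by rewrite ler_weXn2l// mulnC leq_mul2r leq_pmulr// orbT.
Qed.

(** An index occurring for arbitrarily large [k] would have a symbol bounded by all
    the powers [weight ^ -k], so a symbol equal to 0, because [lambda xi != 0] makes
    its weight larger than 1.  Hence the sequence leaves every finite set of
    indices, in particular the set of those with small eigenvalues. *)
Lemma violating_sequence : ~ symbol_lower_bound -> exists x : nat -> Z,
  (forall k, [/\ I (x k), sigma (x k) != 0 &
     Normc.normc (sigma (x k)) <= W (x k) ^- k.+1]) /\
  exists k0, forall k, (k0 <= k)%N -> 4 <= W (x k).
Proof.
move=> nb.
have /choice[x xP] k : exists xi, [/\ I xi, sigma xi != 0, lambda xi != 0 &
    Normc.normc (sigma xi) <= W xi ^- k.+1].
  apply: contrapT => nk; apply: nb; exists k.+1%:R; first by rewrite ltr0n.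
  move=> xi Ixi s0 l0; rewrite ltNge weight_powN//; apply/negP => le.
  by apply: nk; exists xi.
exists x; split; first by move=> k; have [] := xP k.
have [n low] := low_eigenvalues sys (4 ^+ m).
have avoid xi : exists k0, forall k, (k0 <= k)%N -> x k != xi.
  have [[j /eqP jx]|nx] := pselect (exists j, x j == xi); last first.
    by exists 0%N => k _; apply/negP => kx; apply: nx; exists k.
  have [_ s0 l0 _] := xP j; rewrite jx in s0 l0.
  have W1 := weight_gt1 m_gt0 l0.
  have n0 : 0 < Normc.normc (sigma xi).
    have := abs2_gt0 s0; rewrite -normc_sqr.
    by rewrite exprn_even_gt0//= lt_def => ->; case: (sigma xi) => ? ?; exact: sqrtr_ge0.
  have [k0 k0P] := exprn_unbounded (Normc.normc (sigma xi))^-1 W1.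
  exists k0 => k kk; apply/eqP => kx.
  have [_ _ _] := xP k; rewrite kx leNgt => /negP; apply.
  have Wk0 : 0 < W xi ^+ k.+1 by rewrite exprn_gt0// (lt_trans ltr01).
  by rewrite -[ltRHS]invrK ltf_pV2 ?posrE ?invr_gt0//; apply: k0P; exact: leqW.
have [k0 k0P] : exists k0, forall k, (k0 <= k)%N -> x k \notin index_ball R I n.
  elim: (index_ball R I n) => [|xi s [k1 IH]]; first by exists 0%N.
  have [k2 H2] := avoid xi; exists (maxn k1 k2) => k; rewrite geq_max.
  by move=> /andP[h1 h2]; rewrite inE negb_or H2// IH.
exists k0 => k kk; have [Ix _ _ _] := xP k.
apply: weight_ge => //; rewrite leNgt; apply/negP => /(low _ Ix).
by rewrite (negPf (k0P k kk)).
Qed.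

(** Necessity.  With [w] the weight at [x k] and [k = p + j], solvability gives
    [w ^ (2 (k + 1)) <= 2 a 4 ^ k w ^ (2 p)], that is
    [w ^ (2 (j + 1)) <= 2 a 4 ^ p 4 ^ j].  Since [w >= 4], the left-hand side is at
    least [4 ^ j * 4 ^ j], which is too large as soon as [2 a 4 ^ p < 4 ^ j]. *)
Lemma lower_bound_of_solvable (P : V -> V) : fourier_multiplier L I v P sigma ->
  globally_solvable L I v P sigma -> symbol_lower_bound.
Proof.
move=> hP solv; apply: contrapT => /violating_sequence[x [xP [k0 W4]]].
have onb := eigensystem_onb sys; have dL := eigensystem_diagonal sys.
have [c [cx c0 cs]] := square_summable_along R x.
have [||a a0 [N aN]] :=
  @solvable_Fourier_quotient _ _ _ _ _ _ _ _ _ onb dL _ _ hP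
    (fun xi => Complex (c xi) 0) _ _ solv.
- move=> xi Ixi s0; rewrite c0// => k; apply/eqP => kx.
  by have [_ + _] := xP k; rewrite kx s0 eqxx.
- exists 2 => n; apply: le_trans (cs _ (index_ball_uniq R I n)).
  by apply: ler_sum => xi _; rewrite /abs2 /= expr0n addr0.
pose p := (m * N)%N.
have [j0 j0P] := @exprn_unbounded R 4 (2 * a * 4 ^+ p) (ltr1n R 4).
pose j := (j0 + k0)%N; pose k := (p + j)%N.
have [Ix s0 sW] := xP k.
have W0 : 4 <= W (x k) by apply: W4; rewrite /k /j addnA leq_addl.
have := aN _ Ix; rewrite {1}/abs2 /= expr0n addr0 -normc_sqr.
have lW := weightX lambda m_gt0 (x k).
set w := W (x k) in sW W0 lW *.
have w1 : 1 <= w by apply: le_trans W0; rewrite ler1n.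
have w0 : 0 < w by apply: lt_le_trans w1.
apply/negP; rewrite -ltNge.
apply: (@le_lt_trans _ _ (w ^- k.+1 ^+ 2 * (a * (2 * w ^+ (2 * p))))).
  apply: ler_pM; rewrite ?sqr_ge0 ?mulr_ge0 ?addr_ge0 ?exprn_ge0 ?abs2_ge0 ?(ltW a0)//.
    apply: lerXn2r => //; rewrite nnegrE; last by rewrite invr_ge0 exprn_ge0 ?ltW.
    by case: (sigma (x k)) => ? ?; exact: sqrtr_ge0.
  rewrite ler_pM2l// mulr2n mulrDl mul1r lerD ?exprn_ege1//.
  rewrite /p mulnA exprM lW; apply: lerXn2r; rewrite ?nnegrE ?abs2_ge0//.
    by rewrite addr_ge0 ?abs2_ge0.
  by rewrite lerDr.
apply: (@lt_le_trans _ _ ((2 ^- k) ^+ 2)); last first.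
  apply: lerXn2r => //; rewrite nnegrE; first by rewrite invr_ge0 exprn_ge0.
  by apply: le_trans (cx k); rewrite invr_ge0 exprn_ge0.
rewrite !exprVn -!exprM ltr_pdivrMl ?exprn_gt0// ltr_pdivlMr ?exprn_gt0//.
have -> : (k.+1 * 2 = 2 * p + 2 * j.+1)%N by rewrite /k mulnC -addnS mulnDr.
rewrite exprD (mulnC k) [X in _ * X]exprM (_ : 2 ^+ 2 = 4 :> R); last by rewrite -natrX.
rewrite !mulrA [_ * w ^+ _]mulrC -!mulrA ltr_pM2l ?exprn_gt0//.
rewrite /k exprD.
apply: (@lt_le_trans _ _ (4 ^+ j * 4 ^+ j)).
  rewrite !mulrA [a * 2]mulrC ltr_pM2r ?exprn_gt0//.
  by apply: j0P; exact: leq_addr.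
rewrite -exprD addnn -mul2n; apply: (@le_trans _ _ (w ^+ (2 * j))).
  by apply: lerXn2r; rewrite ?nnegrE// ltW.
by rewrite ler_weXn2l// leq_mul2l leqnSn.
Qed.

End lower_bounds.

(* The condition [lambda xi != 0], i.e. [1 < weight m lambda xi], is necessary:
   when [lambda xi = 0] the weight is 1 for every M and the inequality would
   demand [1 < |sigma xi|], which fails for the (solvable) identity operator. *)
Theorem theorem3p8 (R : realType) (n : nat) (Omega : set 'rV[R]_n)
    (oOmega : open Omega) (bOmega : bounded_set Omega)
    (m : nat) (m_gt0 : (0 < m)%N)
    (a : multiindex n m -> 'rV[R]_n -> R[i]) (ha : diff_coeffs Omega a)
    (BC : set (L2space (lebesgue_on oOmega))) (linBC : linear_space BC)
    (L : operator (lebesgue_on oOmega)) (defL : L = diff_operator a BC)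
    (complL : Hinf_complete L) (complLstar : Hinf_complete (adjoint L))
    (K : nat) (K_gt0 : (0 < K)%N) (I : set 'rV[int]_K)
    (lambda : 'rV[int]_K -> R[i])
    (u v : 'rV[int]_K -> L2space (lebesgue_on oOmega))
    (sys : eigensystem L I lambda u v)
    (P : L2space (lebesgue_on oOmega) -> L2space (lebesgue_on oOmega))
    (sigma : 'rV[int]_K -> R[i]) (hP : fourier_multiplier L I v P sigma) :
  globally_solvable L I v P sigma <->
  exists2 M : R, 0 < M &
    forall xi, I xi -> sigma xi != 0 -> lambda xi != 0 ->
      weight m lambda xi `^ (- M) < Normc.normc (sigma xi).
Proof.
split=> [solv|lb].
  exact: (lower_bound_of_solvable sys m_gt0 hP solv).
have [c c0 [N cN]] := inverse_bound_of_lower_bound sys m_gt0 lb.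
exact: (solvable_of_inverse_bound (eigensystem_onb sys)
  (eigensystem_diagonal sys) hP c0 cN).
Qed.
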